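(* The set $\mathrm{orb}(\mathsf S_T)$ of point orbits of $\mathsf S_T$ consists exactly of the following elements: (1) the singletons $\{T\}$, $\{T^\phi\}$, $\{T^{\phi^2}\}$; (2) one Type-II-$T$-sls, one Type-II-$T^\phi$-sls and one Type-II-$T^{\phi^2}$-sls; (3) $q-2$ Type-III-$T$-slses, $q-2$ Type-III-$T^\phi$-slses and $q-2$ Type-III-$T^{\phi^2}$-slses; (4) $\mathcal P_{2,q}$, which contains only Type I points and only Type I lines; (5) $q^3-q-3$ $\mathbb{F}_q$-planes which consist of only Type II points and only Type III lines; (6) $q^3-q-3$ $\mathbb{F}_q$-planes which consist of only Type III points and only Type II lines; (7) $q^4-3q^3+q+6$ $\mathbb{F}_q$-planes which consist of only Type III points and only Type III lines.
   Context: Let $q$ be a prime power, $\mathbb{F}_q$ the field of order $q$, $\mathbb{F}_{q^3}^*=\mathbb{F}_{q^3}\setminus\{0\}$. Points of $\mathrm{PG}(2,q^3)$ have homogeneous coordinates $(x,y,z)$ and lines $[a,b,c]$, a point lying on a line iff the dot product of the coordinate vectors is $0$. An $\mathbb{F}_q$-plane is a subplane of order $q$ of $\mathrm{PG}(2,q^3)$; its lines are the lines of $\mathrm{PG}(2,q^3)$ meeting it in $q+1$ points. Let $\phi$ be the collineation $(x,y,z)\mapsto(z^q,x^q,y^q)$, acting on lines by $[d,e,f]\mapsto[f^q,d^q,e^q]$; its fixed points form the $\mathbb{F}_q$-plane $\mathcal P_{2,q}=\{(x,x^q,x^{q^2}):x\in\mathbb{F}_{q^3}^*\}$. A point has Type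 I, II or III according as its $\phi$-orbit is one point, three collinear points, or three non-collinear points; a line has Type I, II or III according as its $\phi$-orbit is one line, three concurrent lines, or three non-concurrent lines (equivalently, it meets $\mathcal P_{2,q}$ in $q+1$, $1$ or $0$ points). Let $T=(0,0,1)$, so $T^\phi=(1,0,0)$, $T^{\phi^2}=(0,1,0)$. For $t\in\mathbb{F}_{q^3}^*$ let $\psi_t$ be the collineation $(x,y,z)\mapsto(tx,t^qy,t^{q^2}z)$, and let $\mathsf S_T=\{\psi_t: t\in\mathbb{F}_{q^3}^*\}$ (the subgroup of $\mathrm{PGL}(3,q^3)$ fixing $\mathcal P_{2,q}$ setwise and the line $T^\phi T^{\phi^2}$ setwise). $\mathrm{orb}(\mathsf S_T)$ denotes the set of point orbits of $\mathsf S_T$. The point orbits of $\mathsf S_T$ of size $q^2+q+1$ contained in the line $T^\phi T^{\phi^2}$ (respectively $T^{\phi^2}T$, $TT^\phi$) are called $T$-slses (respectively $T^\phi$-slses, $T^{\phi^2}$-slses). Such an sls is called Type-X (X $\in\{$II, III$\}$) if all its points have Type X. *)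

(* Defs.v *)
From HB Require Import structures.
From mathcomp Require Import all_boot all_order all_algebra all_field.
Unset Implicit Arguments.
Import GRing.Theory.
Local Open Scope ring_scope.

(* The projective plane PG(2,K) with K = F_{q^3} a finite field.
   Vectors are triples over K; a point (and likewise a line, given by its
   coordinate vector [a,b,c]) is represented by the set of all nonzero scalar
   multiples of a nonzero vector (i.e. a projective point as a set of
   homogeneous coordinate vectors). *)
Section PG.
Variable K : finFieldType.
Variable q : nat.

Definition vec := (K * K * K)%type.
Definition v0 : vec := (0, 0, 0).
Definition mkv (x y z : K) : vec := (x, y, z).
Definition smul (k : K) (v : vec) : vec := (k * v.1.1, k * v.1.2, k * v.2).
Definition dot (l v : vec) : K := l.1.1 * v.1.1 + l.1.2 * v.1.2 + l.2 * v.2.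

Definition pt (v : vec) : {set vec} := [set smul k v | k : K & k != 0].

Definition PGpoints : {set {set vec}} := [set pt v | v : vec & v != v0].
Definition PGlines : {set {set vec}} := [set pt v | v : vec & v != v0].

Definition incident (P L : {set vec}) : bool :=
  [exists v in P, exists l in L, dot l v == 0].

Definition collinear (P1 P2 P3 : {set vec}) : bool :=
  [exists L in PGlines, [&& incident P1 L, incident P2 L & incident P3 L]].
Definition concurrent (L1 L2 L3 : {set vec}) : bool :=
  [exists P in PGpoints, [&& incident P L1, incident P L2 & incident P L3]].

(* the collineation phi : (x,y,z) |-> (z^q, x^q, y^q); on lines
   [d,e,f] |-> [f^q, d^q, e^q] (same formula on coordinate vectors) *)
Definition phiv (v : vec) : vec := (v.2 ^+ q, v.1.1 ^+ q, v.1.2 ^+ q).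
Definition phiS (S : {set vec}) : {set vec} := phiv @: S.

Definition typeI_pt (P : {set vec}) : bool := phiS P == P.
Definition typeII_pt (P : {set vec}) : bool :=
  (phiS P != P) && collinear P (phiS P) (phiS (phiS P)).
Definition typeIII_pt (P : {set vec}) : bool :=
  (phiS P != P) && ~~ collinear P (phiS P) (phiS (phiS P)).
Definition typeI_ln (L : {set vec}) : bool := phiS L == L.
Definition typeII_ln (L : {set vec}) : bool :=
  (phiS L != L) && concurrent L (phiS L) (phiS (phiS L)).
Definition typeIII_ln (L : {set vec}) : bool :=
  (phiS L != L) && ~~ concurrent L (phiS L) (phiS (phiS L)).

Definition psiv (t : K) (v : vec) : vec :=
  (t * v.1.1, t ^+ q * v.1.2, t ^+ (q ^ 2)%N * v.2).
Definition psiS (t : K) (S : {set vec}) : {set vec} := psiv t @: S.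

Definition orbitST (P : {set vec}) : {set {set vec}} :=
  [set psiS t P | t : K & t != 0].
Definition orbST : {set {set {set vec}}} := [set orbitST P | P in PGpoints].

Definition T : {set vec} := pt (mkv 0 0 1).
Definition Tphi : {set vec} := phiS T.
Definition Tphi2 : {set vec} := phiS Tphi.

Definition P2q : {set {set vec}} :=
  [set pt (mkv x (x ^+ q) (x ^+ (q ^ 2)%N)) | x : K & x != 0].

Definition in_line_AB (A B : {set vec}) (O : {set {set vec}}) : bool :=
  [exists L in PGlines,
     [&& incident A L, incident B L & [forall P in O, incident P L]]].

Definition sls_on (A B : {set vec}) (O : {set {set vec}}) : bool :=
  (O \in orbST) && (#|O| == (q ^ 2 + q + 1)%N) && in_line_AB A B O.
Definition T_sls := sls_on Tphi Tphi2.
Definition Tphi_sls := sls_on Tphi2 T.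
Definition Tphi2_sls := sls_on T Tphi.

Definition all_pts (pr : {set vec} -> bool) (O : {set {set vec}}) : bool :=
  [forall P in O, pr P].

Definition nmeet (S : {set {set vec}}) (L : {set vec}) : nat :=
  #|[set P in S | incident P L]|.

(* F_q-plane: a subplane of order q of PG(2,q^3). Its lines are the lines
   meeting it in at least 2 points; the axioms of a projective plane of order
   q: two such lines meet in a point of S, each such line has q+1 points of S,
   and S contains a quadrangle (4 points, no 3 collinear). *)
Definition secant (S : {set {set vec}}) (L : {set vec}) : bool :=
  (1 < nmeet S L)%N.
Definition Fq_plane (S : {set {set vec}}) : bool :=
  [&& S \subset PGpoints,
      [forall L1 in PGlines, forall L2 in PGlines,
         [&& secant S L1, secant S L2 & L1 != L2] ==>
         [exists P in S, incident P L1 && incident P L2]],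
      [forall L in PGlines, secant S L ==> (nmeet S L == q.+1)] &
      [exists P1 in S, exists P2 in S, exists P3 in S, exists P4 in S,
         [&& ~~ collinear P1 P2 P3, ~~ collinear P1 P2 P4,
             ~~ collinear P1 P3 P4 & ~~ collinear P2 P3 P4]]].

Definition all_lines_of (pr : {set vec} -> bool) (S : {set {set vec}}) : bool :=
  [forall L in PGlines, (nmeet S L == q.+1) ==> pr L].

End PG.

(* Main.v *)
(** Write [N] and [Tr] for the norm and trace to the field of order [q].  A point
[(x, y, z)] is collinear with its [phi]-orbit iff
[N x + N y + N z = Tr (x y^q z^(q^2))], and then, by descent, it lies on a line
[[m, m^q, m^(q^2)]].  The orbit of a point [(a, b, c)] off the triangle
[T, T^phi, T^(phi^2)] is the image of [P_(2,q)] under the diagonal matrix with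
entries [a, b, c]; it meets the line [[d, e, f]] in the zeros [t], up to [F_q^*],
of the linearized polynomial [a d t + b e t^q + c f t^(q^2)], and its lines are
the orbit of [[1/a, 1/b, 1/c]].  So inverting coordinates exchanges (5) and (6).
A type II orbit off the triangle has exactly one point on [x + y + z = 0], which
counts (5).
If [(a, b, c)] and [(1/a, 1/b, 1/c)] both satisfy the norm-trace equation, then
[u = a b^q c^(q^2)] has characteristic polynomial [(X - N a)(X - N b)(X - N c)],
so [u = N a = N b = N c] and the point has type I; hence (5) and (6) are
disjoint, and (7) is what remains of the [(q - 1)(q^3 - 1)] orbits off the
triangle.  On the side [z = 0] the orbit of [(1, z, 0)] is determined by [N z],
and it has type II iff [N z = -1]. *)

Require Import Defs.
From mathcomp Require Import all_boot all_order all_algebra all_field.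
From mathcomp Require Import zify ring.
Import GRing.Theory.
Local Open Scope ring_scope.
Set Implicit Arguments.
Unset Strict Implicit.
Unset Printing Implicit Defensive.

(** * Counting by fibres and by polynomial roots *)

Lemma card_fibres (aT rT : finType) (A : {set aT}) (f : aT -> rT) (m : nat) :
  {in A, forall x, #|[set y in A | f y == f x]| = m} -> #|A| = (#|f @: A| * m)%N.
Proof.
move=> Hm; rewrite -sum1_card (partition_big_imset f) /=.
rewrite -sum_nat_const; apply: eq_bigr => _ /imsetP[x xA ->].
by rewrite -(Hm x xA) -sum1_card; apply: eq_bigl => y; rewrite inE.
Qed.

Lemma card_roots_lt (K : finFieldType) (p : {poly K}) (A : {set K}) :
  p != 0 -> {in A, forall x, root p x} -> (#|A| < size p)%N.
Proof.
move=> p0 Ap; rewrite cardE; apply: max_poly_roots => //; last exact: enum_uniq.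
by apply/allP => x; rewrite mem_enum => /Ap.
Qed.

(** * The Frobenius map, the norm and the subfield of order q *)

Section Frobenius.
Variables (K : finFieldType) (q : nat).
Hypothesis q_gt1 : (1 < q)%N.
Hypothesis cardK : #|K| = (q ^ 3)%N.
Hypothesis frobD : forall x y : K, (x + y) ^+ q = x ^+ q + y ^+ q.

Definition fr (x : K) : K := x ^+ q.
Definition norm3 (x : K) : K := x * fr x * fr (fr x).
Definition tr3 (x : K) : K := x + fr x + fr (fr x).

Lemma frE x : x ^+ q = fr x. Proof. by []. Qed.
Lemma frq2E x : x ^+ (q ^ 2) = fr (fr x).
Proof. by rewrite /fr -exprM -mulnn. Qed.
Lemma frD x y : fr (x + y) = fr x + fr y. Proof. exact: frobD. Qed.
Lemma frM x y : fr (x * y) = fr x * fr y. Proof. exact: exprMn. Qed.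
Lemma fr0 : fr 0 = 0. Proof. by rewrite /fr expr0n eqn0Ngt (ltnW q_gt1). Qed.
Lemma fr1 : fr 1 = 1. Proof. exact: expr1n. Qed.
Lemma frN x : fr (- x) = - fr x.
Proof. by apply/eqP; rewrite -addr_eq0 -frD addNr fr0. Qed.
Lemma frB x y : fr (x - y) = fr x - fr y. Proof. by rewrite frD frN. Qed.
Lemma frV x : fr x^-1 = (fr x)^-1. Proof. exact: exprVn. Qed.
Lemma fr3 x : fr (fr (fr x)) = x.
Proof. by rewrite /fr -!exprM -[RHS]expf_card cardK; congr (_ ^+ _); lia. Qed.
Lemma fr_inj : injective fr.
Proof. by apply: (can_inj (g := fr \o fr)) => x /=; rewrite fr3. Qed.
Lemma fr_eq0 x : (fr x == 0) = (x == 0).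
Proof. by rewrite -{1}fr0 (inj_eq fr_inj). Qed.

(** These rules push Frobenius down to the variables and reduce its iterates modulo 3, so that
    [ring] can treat [x], [fr x] and [fr (fr x)] as independent atoms. *)
Definition frsimp := (frD, frM, frN, frV, fr0, fr1, fr3).

Lemma norm3M x y : norm3 (x * y) = norm3 x * norm3 y.
Proof. by rewrite /norm3 !frsimp; ring. Qed.
Lemma norm3V x : norm3 x^-1 = (norm3 x)^-1.
Proof. by rewrite /norm3 !frsimp !invfM. Qed.
Lemma norm3_eq0 x : (norm3 x == 0) = (x == 0).
Proof. by rewrite /norm3 !mulf_eq0 !fr_eq0 !orbb. Qed.
Lemma fr_norm3 x : fr (norm3 x) = norm3 x.
Proof. by rewrite /norm3 !frsimp; ring. Qed.
Lemma cardK1 : #|[set x : K | x != 0]| = ((q ^ 2 + q + 1) * (q - 1))%N.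
Proof.
have -> : [set x : K | x != 0] = [set~ 0] by apply/setP => x; rewrite !inE.
by rewrite cardsC1 cardK; nia.
Qed.

(** The exponents 1, q and q^2 are distinct, so d X + e X^q + f X^(q^2) is a nonzero polynomial and
    its degree bounds its roots. *)
Lemma card_kernel_poly (d e f : K) : (d, e, f) != v0 K ->
  (#|[set t | d * t + e * fr t + f * fr (fr t) == 0]%R| <= q ^ 2)%N.
Proof.
move=> def0; pose p := d *: 'X + e *: 'X^q + f *: 'X^(q ^ 2).
have sp : (size p <= (q ^ 2).+1)%N.
  apply: leq_trans (size_polyD _ _) _; rewrite geq_max; apply/andP; split.
    apply: leq_trans (size_polyD _ _) _; rewrite geq_max; apply/andP; split;
    apply: leq_trans (size_scale_leq _ _) _; rewrite ?size_polyX ?size_polyXn; nia.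
  by apply: leq_trans (size_scale_leq _ _) _; rewrite size_polyXn.
have p0 : p != 0.
  apply: contraNneq def0 => p0.
  have co i : d * (i == 1)%:R + e * (i == q)%:R + f * (i == q ^ 2)%N%:R = 0.
    by rewrite -[RHS](coef0 _ i) -p0 !coefE /= ?coefXn.
  have q1 : (q == 1)%N = false by lia.
  have q2 : (q == q ^ 2)%N = false by nia.
  have q3 : (q ^ 2 == 1)%N = false by nia.
  have := co 1; have := co q; have := co (q ^ 2)%N.
  rewrite !eqxx q1 q2 q3 eq_sym q2 eq_sym q1 eq_sym q3.
  by rewrite !(mulr0, mulr1, addr0, add0r) => -> -> ->.
rewrite -ltnS; apply: leq_trans sp; apply: card_roots_lt => // x.
by rewrite inE rootE !hornerE ?hornerXn frE frq2E.
Qed.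

Definition Fq : {set K} := [set x | fr x == x].

Lemma Fq0 : 0 \in Fq. Proof. by rewrite inE fr0. Qed.
(** The roots of X^q - X give only an upper bound; equality comes from the count in
    [card_Fq1_hilbert90]. *)
Lemma card_Fq_le : (#|Fq| <= q)%N.
Proof.
have sq : size ('X^q - 'X : {poly K}) = q.+1.
  by rewrite size_polyDl ?size_polyXn // size_polyN size_polyX.
rewrite -ltnS -sq; apply: card_roots_lt; first by rewrite -size_poly_eq0 sq.
by move=> x; rewrite inE rootE !hornerE ?hornerXn subr_eq0.
Qed.

Lemma card_FqE : #|Fq| = #|[set x in Fq | x != 0]|.+1.
Proof.
rewrite (cardsD1 0) Fq0 add1n; congr _.+1.
by apply: eq_card => x; rewrite !inE andbC.
Qed.

Lemma card_norm3_fibre_le (c : K) : (#|[set x | norm3 x == c]%R| <= q ^ 2 + q + 1)%N.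
Proof.
have sq : size ('X^(q ^ 2 + q + 1) - c%:P : {poly K}) = (q ^ 2 + q + 1).+1.
  by rewrite size_XnsubC // addn1.
rewrite -ltnS -sq; apply: card_roots_lt; first by rewrite -size_poly_eq0 sq.
move=> x; rewrite inE rootE !hornerE ?hornerXn subr_eq0 => /eqP <-.
by rewrite /norm3 !exprD frE frq2E expr1; apply/eqP; ring.
Qed.

Lemma norm3_fr_div t : t != 0 -> norm3 (fr t / t) = 1.
Proof.
move=> t0; have norm_fr : norm3 (fr t) = norm3 t by rewrite /norm3 !frsimp; ring.
by rewrite norm3M norm3V norm_fr mulfV ?norm3_eq0.
Qed.

Lemma fr_div_eq s t : s != 0 -> t != 0 ->
  (fr s / s == fr t / t) = (s / t \in Fq).
Proof.
move=> s0 t0; rewrite inE frM frV eqr_div // eqr_div ?fr_eq0 //.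
by rewrite [s * _]mulrC.
Qed.

Lemma card_fr_div_fibre t : t != 0 ->
  #|[set s in [set x : K | x != 0] | fr s / s == fr t / t]|
    = #|[set x in Fq | x != 0]|.
Proof.
move=> t0; rewrite -(card_imset [set x in Fq | x != 0] (mulfI t0)).
apply: eq_card => s; apply/idP/imsetP => [|[x]]; rewrite !inE.
  case/andP=> s0; rewrite fr_div_eq // inE => st.
  by exists (s / t); rewrite ?inE ?st ?mulf_neq0 ?invr_eq0 // mulrCA mulfV ?mulr1.
case/andP=> xF x0 ->; rewrite mulf_neq0 //= fr_div_eq ?mulf_neq0 //.
by rewrite mulrAC mulfV // mul1r inE.
Qed.

(* The fibres of t |-> t^(q-1) on K^* are cosets of Fq^*, and its values have
   norm 1; both are bounded by degree, so both bounds are attained. *)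
Lemma card_Fq1_hilbert90 :
  #|[set x in Fq | x != 0]| = (q - 1)%N /\
  [set fr t / t | t in [set x : K | x != 0]] = [set x | norm3 x == 1].
Proof.
set A := [set x : K | x != 0]; set F := [set x in Fq | _].
have HF : (#|F| <= q - 1)%N.
  by have := card_Fq_le; rewrite card_FqE -/F; lia.
have fib : {in A, forall t, #|[set s in A | fr s / s == fr t / t]| = #|F|}.
  by move=> t; rewrite inE => /card_fr_div_fibre.
have := card_fibres fib; rewrite cardK1.
set I := [set _ | t in A] => E.
have sub : I \subset [set x | norm3 x == 1].
  by apply/subsetP => _ /imsetP[t + ->]; rewrite !inE => t0; rewrite norm3_fr_div.
have le1 := subset_leq_card sub; have le2 := card_norm3_fibre_le 1.
have F_eq : #|F| = (q - 1)%N by nia.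
split=> //; apply/eqP; rewrite eqEcard sub /=.
by move/eqP: E; rewrite F_eq eqn_pmul2r ?subn_gt0 // => /eqP <-.
Qed.

Lemma card_Fq1 : #|[set x in Fq | x != 0]| = (q - 1)%N.
Proof. by case: card_Fq1_hilbert90. Qed.

Lemma card_Fq : #|Fq| = q.
Proof. by rewrite card_FqE card_Fq1; lia. Qed.

Lemma hilbert90 x : norm3 x = 1 -> exists2 t, t != 0 & x = fr t / t.
Proof.
move=> Nx; have : x \in [set x | norm3 x == 1] by rewrite inE Nx.
have [_ <-] := card_Fq1_hilbert90.
by case/imsetP=> t; rewrite inE => t0 ->; exists t.
Qed.

(** The fibre is the coset of [c] modulo the elements of norm 1, and these are counted as the values
    of t^(q-1), each taken q - 1 times. *)
Lemma card_norm3_fibre (c : K) : c != 0 ->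
  #|[set x | norm3 x == norm3 c]| = (q ^ 2 + q + 1)%N.
Proof.
move=> c0; have [_ H] := card_Fq1_hilbert90.
have fib : {in [set x : K | x != 0], forall t,
   #|[set s in [set x : K | x != 0] | fr s / s == fr t / t]| = (q - 1)%N}.
  by move=> t; rewrite inE => /card_fr_div_fibre ->; rewrite card_Fq1.
have := card_fibres fib; rewrite H cardK1 => E.
have -> : [set x | norm3 x == norm3 c] = [set c * x | x in [set x | norm3 x == 1]].
  apply/setP => x; apply/idP/imsetP => [|[y]]; rewrite !inE => /eqP Nx.
    exists (x / c); last by rewrite mulrCA mulfV ?mulr1.
    by rewrite inE norm3M norm3V Nx mulfV ?norm3_eq0.
  by move=> ->; rewrite norm3M Nx mulr1.
rewrite card_imset; last exact: mulfI.
by move/eqP: E; rewrite eqn_pmul2r ?subn_gt0 // => /eqP <-.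
Qed.

(** * Coordinates and types of points and lines *)

Local Notation vec := (Defs.vec K).
Local Notation v0 := (Defs.v0 K).
Local Notation smul := (Defs.smul K).
Local Notation dot := (Defs.dot K).
Local Notation pt := (Defs.pt K).
Local Notation phi := (Defs.phiv K q).
Local Notation psi := (Defs.psiv K q).
Local Notation PGpoints := (Defs.PGpoints K).
Local Notation PGlines := (Defs.PGlines K).
Local Notation incident := (Defs.incident K).
Local Notation phiS := (Defs.phiS K q).

Lemma vec_eq0 (a b c : K) : ((a, b, c) == v0) = [&& a == 0, b == 0 & c == 0].
Proof. by rewrite !xpair_eqE andbA. Qed.

Lemma smulE k a b c : smul k (a, b, c) = (k * a, k * b, k * c). Proof. by []. Qed.
Lemma dotE a b c d e f : dot (a, b, c) (d, e, f) = a * d + b * e + c * f.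
Proof. by []. Qed.
Lemma phiE a b c : phi (a, b, c) = (fr c, fr a, fr b). Proof. by []. Qed.
Lemma psiE t a b c : psi t (a, b, c) = (t * a, fr t * b, fr (fr t) * c).
Proof. by rewrite /psiv /= frq2E. Qed.

Lemma smulA k m v : smul k (smul m v) = smul (k * m) v.
Proof. by rewrite /smul /= !mulrA. Qed.
Lemma smul1 v : smul 1 v = v.
Proof. by case: v => [[a b] c]; rewrite /smul /= !mul1r. Qed.
Lemma smul_eq0 k v : (smul k v == v0) = (k == 0) || (v == v0).
Proof.
case: v => [[a b] c]; rewrite /smul /= !vec_eq0 !mulf_eq0.
by case: (k == 0).
Qed.
Lemma phi_smul k v : phi (smul k v) = smul (fr k) (phi v).
Proof. by case: v => [[a b] c]; rewrite smulE !phiE smulE !frM. Qed.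
Lemma psi_smul t k v : psi t (smul k v) = smul k (psi t v).
Proof. by case: v => [[a b] c]; rewrite smulE !psiE smulE; congr (_, _, _); ring. Qed.
Lemma phi_psi t v : phi (psi t v) = psi t (phi v).
Proof. by case: v => [[a b] c]; rewrite psiE !phiE psiE !frM fr3. Qed.
Lemma psiM s t v : psi s (psi t v) = psi (s * t) v.
Proof. by case: v => [[a b] c]; rewrite !psiE !frM !mulrA. Qed.
Lemma psi1 v : psi 1 v = v.
Proof. by case: v => [[a b] c]; rewrite !psiE !fr1 !mul1r. Qed.
Lemma phi3 v : phi (phi (phi v)) = v.
Proof. by case: v => [[a b] c]; rewrite !phiE !fr3. Qed.
Lemma phi_eq0 v : (phi v == v0) = (v == v0).
Proof.
by case: v => [[a b] c]; rewrite phiE !vec_eq0 !fr_eq0; case: (c == 0); rewrite ?andbF ?andbT.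
Qed.
Lemma psi_eq0 t v : t != 0 -> (psi t v == v0) = (v == v0).
Proof.
by move=> /negPf t0; case: v => [[a b] c]; rewrite psiE !vec_eq0 !mulf_eq0 !fr_eq0 t0.
Qed.

Lemma dotC u v : dot u v = dot v u.
Proof. by rewrite /dot /=; ring. Qed.
Lemma dot_smulr k u v : dot u (smul k v) = k * dot u v.
Proof. by rewrite /dot /=; ring. Qed.
Lemma dot_smull k u v : dot (smul k u) v = k * dot u v.
Proof. by rewrite /dot /=; ring. Qed.
Lemma dot_phi u v : dot (phi u) (phi v) = fr (dot u v).
Proof.
case: u v => [[a b] c] [[d e] f].
by rewrite !phiE !dotE !frD !frM; ring.
Qed.

Lemma mem_pt v w : reflect (exists2 k, k != 0 & w = smul k v) (w \in pt v).
Proof.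
apply: (iffP imsetP) => -[k]; first by rewrite inE; exists k.
by move=> k0 ->; exists k; rewrite ?inE.
Qed.

Lemma mem_pt_self v : v \in pt v.
Proof. by apply/mem_pt; exists 1; rewrite ?oner_eq0 ?smul1. Qed.

Lemma pt_eq v w : reflect (exists2 k, k != 0 & w = smul k v) (pt v == pt w).
Proof.
apply: (iffP eqP) => [E | [k k0 ->]].
  by apply/mem_pt; rewrite E mem_pt_self.
apply/setP => u; apply/mem_pt/mem_pt => -[m m0 ->].
  by exists (m / k); rewrite ?mulf_neq0 ?invr_eq0 // smulA mulfVK.
by exists (m * k); rewrite ?mulf_neq0 // smulA.
Qed.

Lemma pt_smul k v : k != 0 -> pt (smul k v) = pt v.
Proof. by move=> k0; apply/esym/eqP/pt_eq; exists k. Qed.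

Lemma phiS_pt v : phiS (pt v) = pt (phi v).
Proof.
apply/setP => w; apply/imsetP/mem_pt => [[_ /mem_pt[k k0 ->] ->]|[k k0 ->]].
  by exists (fr k); rewrite ?fr_eq0 ?phi_smul.
exists (smul (fr (fr k)) v); last by rewrite phi_smul fr3.
by apply/mem_pt; exists (fr (fr k)); rewrite ?fr_eq0.
Qed.

Lemma psiS_pt t v : psiS K q t (pt v) = pt (psi t v).
Proof.
apply/setP => w; apply/imsetP/mem_pt => [[_ /mem_pt[k k0 ->] ->]|[k k0 ->]].
  by exists k; rewrite ?psi_smul.
by exists (smul k v); rewrite ?psi_smul //; apply/mem_pt; exists k.
Qed.

Lemma incident_pt v l : incident (pt v) (pt l) = (dot l v == 0).
Proof.
apply/exists_inP/idP => [[_ /mem_pt[k k0 ->]] | lv].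
  case/exists_inP=> _ /mem_pt[m m0 ->].
  by rewrite dot_smull dot_smulr !mulf_eq0 (negPf k0) (negPf m0).
by exists v; [exact: mem_pt_self | apply/exists_inP; exists l; first exact: mem_pt_self].
Qed.

Lemma PGpointsP P : reflect (exists2 v, v != v0 & P = pt v) (P \in PGpoints).
Proof.
apply: (iffP imsetP) => -[v]; first by rewrite inE; exists v.
by move=> v_n0 ->; exists v; rewrite ?inE.
Qed.

Lemma PGlinesP L : reflect (exists2 l, l != v0 & L = pt l) (L \in PGlines).
Proof. exact: PGpointsP. Qed.

(** * Cross products, determinants and collinearity *)

Definition cross (u v : vec) : vec :=
  (u.1.2 * v.2 - u.2 * v.1.2, u.2 * v.1.1 - u.1.1 * v.2, u.1.1 * v.1.2 - u.1.2 * v.1.1).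

Lemma dot_crossl u v : dot (cross u v) u = 0.
Proof. by rewrite /dot /=; ring. Qed.
Lemma dot_crossr u v : dot (cross u v) v = 0.
Proof. by rewrite /dot /=; ring. Qed.
(** The triple product u (l.v) - v (l.u) vanishes, so [l] has zero cross product with [cross u v];
    [E12], [E23] and [E13] are its coordinates up to sign. The factor is found by dividing by a
    nonzero coordinate of [cross u v]. *)
Lemma cross_unique u v l : cross u v != v0 -> dot l u = 0 -> dot l v = 0 ->
  exists k, l = smul k (cross u v).
Proof.
case: u v l => [[u1 u2] u3] [[v1 v2] v3] [[l1 l2] l3].
rewrite /dot /cross /smul vec_eq0 /= => c_n0 lu lv.
set c1 := u2 * v3 - _ in c_n0 *; set c2 := u3 * v1 - _ in c_n0 *.
set c3 := u1 * v2 - _ in c_n0 *.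
have E12 : l1 * c2 = l2 * c1.
  apply/eqP; rewrite -subr_eq0; apply/eqP.
  transitivity (u3 * (l1 * v1 + l2 * v2 + l3 * v3) - v3 * (l1 * u1 + l2 * u2 + l3 * u3)).
    by rewrite /c1 /c2; ring.
  by rewrite lu lv; ring.
have E23 : l2 * c3 = l3 * c2.
  apply/eqP; rewrite -subr_eq0; apply/eqP.
  transitivity (u1 * (l1 * v1 + l2 * v2 + l3 * v3) - v1 * (l1 * u1 + l2 * u2 + l3 * u3)).
    by rewrite /c2 /c3; ring.
  by rewrite lu lv; ring.
have E13 : l1 * c3 = l3 * c1.
  apply/eqP; rewrite -subr_eq0; apply/eqP.
  transitivity (- u2 * (l1 * v1 + l2 * v2 + l3 * v3) + v2 * (l1 * u1 + l2 * u2 + l3 * u3)).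
    by rewrite /c1 /c3; ring.
  by rewrite lu lv; ring.
have [c1z|c1n] := eqVneq c1 0; last first.
  by exists (l1 / c1); congr (_, _, _); apply: (mulIf c1n);
     rewrite ?mulfVK // mulrAC mulfVK // ?E12 ?E13.
have [c2z|c2n] := eqVneq c2 0; last first.
  by exists (l2 / c2); congr (_, _, _); apply: (mulIf c2n);
     rewrite ?mulfVK // mulrAC mulfVK // ?E12 ?E23.
have c3n : c3 != 0 by move: c_n0; rewrite c1z c2z !eqxx.
by exists (l3 / c3); congr (_, _, _); apply: (mulIf c3n);
   rewrite ?mulfVK // mulrAC mulfVK // ?E13 ?E23.
Qed.

Lemma cross_eq0 u v : u != v0 -> cross u v = v0 -> exists k, v = smul k u.
Proof.
case: u v => [[u1 u2] u3] [[v1 v2] v3].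
rewrite /cross /smul vec_eq0 /= => u_n0 [/subr0_eq E23 /subr0_eq E31 /subr0_eq E12].
have [u1z|u1n] := eqVneq u1 0; last first.
  by exists (v1 / u1); congr (_, _, _); apply: (mulIf u1n);
     rewrite ?mulfVK // mulrAC mulfVK // mulrC ?E12 -?E31 mulrC.
have [u2z|u2n] := eqVneq u2 0; last first.
  by exists (v2 / u2); congr (_, _, _); apply: (mulIf u2n);
     rewrite ?mulfVK // mulrAC mulfVK // mulrC ?E23 -?E12 mulrC.
have u3n : u3 != 0 by move: u_n0; rewrite u1z u2z !eqxx.
by exists (v3 / u3); congr (_, _, _); apply: (mulIf u3n);
   rewrite ?mulfVK // mulrAC mulfVK // mulrC ?E31 -?E23 mulrC.
Qed.

Lemma orthogonal_vec u : exists2 l, l != v0 & dot l u = 0.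
Proof.
case: u => [[a b] c]; have [ab0|] := boolP ((a == 0) && (b == 0)).
  case/andP: ab0 => /eqP-> /eqP->; exists (1, 0, 0); rewrite ?vec_eq0 ?oner_eq0 //.
  by rewrite /dot /=; ring.
move=> ab; exists (b, - a, 0); first by rewrite vec_eq0 oppr_eq0 eqxx andbT andbC.
by rewrite /dot /=; ring.
Qed.

(** If [u] and [v] are proportional, a line through [u] and [w] contains [v] as well; if all three
    are proportional, any line through [u] serves. *)
Lemma det_eq0P u v w : u != v0 ->
  (exists l, [/\ l != v0, dot l u = 0, dot l v = 0 & dot l w = 0])
  <-> dot (cross u v) w = 0.
Proof.
move=> u_n0; split=> [[l [l0 lu lv lw]] | det0].
  have [-> | c_n0] := eqVneq (cross u v) v0; first by rewrite /dot /=; ring.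
  have [k E] := cross_unique c_n0 lu lv.
  move: l0 lw; rewrite E smul_eq0 negb_or => /andP[k0 _].
  by move/eqP; rewrite dot_smull mulf_eq0 (negPf k0) => /eqP.
have [uv0 | uv_n0] := eqVneq (cross u v) v0; last first.
  by exists (cross u v); rewrite dot_crossl dot_crossr.
have [uw0 | uw_n0] := eqVneq (cross u w) v0; last first.
  exists (cross u w); rewrite dot_crossl dot_crossr; split=> //.
  by have [k ->] := cross_eq0 u_n0 uv0; rewrite dot_smulr dot_crossl mulr0.
have [l l0 lu] := orthogonal_vec u; exists l.
have [k ->] := cross_eq0 u_n0 uv0; have [m ->] := cross_eq0 u_n0 uw0.
by rewrite !dot_smulr lu !mulr0.
Qed.

Lemma collinear_pt u v w : u != v0 ->
  collinear K (pt u) (pt v) (pt w) = (dot (cross u v) w == 0).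
Proof.
move=> u0; apply/exists_inP/eqP => [[_ /PGlinesP[l l0 ->]] | det0].
  rewrite !incident_pt => /and3P[/eqP lu /eqP lv /eqP lw].
  by apply/(det_eq0P _ _ u0); exists l.
have [l [l0 lu lv lw]] := (det_eq0P v w u0).2 det0.
by exists (pt l); [apply/PGlinesP; exists l | rewrite !incident_pt lu lv lw !eqxx].
Qed.

(** Duality: points and lines have the same representation and [dot] is symmetric. Line types
    thereby reduce to point types. *)
Lemma concurrent_pt u v w :
  concurrent K (pt u) (pt v) (pt w) = collinear K (pt u) (pt v) (pt w).
Proof.
apply/exists_inP/exists_inP => -[_ /PGpointsP[l l0 ->]]; rewrite !incident_pt => H;
exists (pt l); rewrite ?incident_pt; try (by apply/PGpointsP; exists l).
  by rewrite !(dotC l).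
by rewrite (dotC u) (dotC v) (dotC w).
Qed.

(** The determinant with rows [v], [phi v], [phi (phi v)], expanded into norms and a trace. *)
Definition orbit_det (v : vec) : K :=
  norm3 v.1.1 + norm3 v.1.2 + norm3 v.2 - tr3 (v.1.1 * fr v.1.2 * fr (fr v.2)).

Lemma collinear_phi_orbit v : v != v0 ->
  collinear K (pt v) (phiS (pt v)) (phiS (phiS (pt v))) = (orbit_det v == 0).
Proof.
move=> v_n0; rewrite !phiS_pt collinear_pt //; congr (_ == 0).
case: v v_n0 => [[a b] c] _; rewrite /orbit_det /tr3 /norm3 !phiE /dot /cross /=.
by rewrite !frM !fr3; ring.
Qed.

(** Every term is scaled by the norm of [t], so the vanishing of [orbit_det] is a property of the
    whole orbit. *)
Lemma orbit_det_psi t v : orbit_det (psi t v) = norm3 t * orbit_det v.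
Proof.
case: v => [[a b] c]; rewrite psiE /orbit_det /tr3 /norm3 /= !frM !fr3.
by ring.
Qed.

Lemma typeII_lnE v : typeII_ln K q (pt v) = typeII_pt K q (pt v).
Proof. by rewrite /typeII_ln !phiS_pt concurrent_pt /typeII_pt !phiS_pt. Qed.
Lemma typeIII_lnE v : typeIII_ln K q (pt v) = typeIII_pt K q (pt v).
Proof. by rewrite /typeIII_ln !phiS_pt concurrent_pt /typeIII_pt !phiS_pt. Qed.

Lemma typeII_ptE v : v != v0 ->
  typeII_pt K q (pt v) = ~~ typeI_pt K q (pt v) && (orbit_det v == 0).
Proof. by move=> v0; rewrite /typeII_pt collinear_phi_orbit. Qed.
Lemma typeIII_ptE v : v != v0 ->
  typeIII_pt K q (pt v) = ~~ typeI_pt K q (pt v) && (orbit_det v != 0).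
Proof. by move=> v0; rewrite /typeIII_pt collinear_phi_orbit. Qed.

(** The vectors fixed by [phi], used both as points of [P2q] and as coordinates of the lines fixed
    by [phi]. *)
Definition conj_vec (t : K) : vec := (t, fr t, fr (fr t)).

Lemma phi_conj_vec t : phi (conj_vec t) = conj_vec t.
Proof. by rewrite /conj_vec phiE fr3. Qed.

Lemma phi_fixed v : phi v = v -> exists t, v = conj_vec t.
Proof.
case: v => [[a b] c]; rewrite phiE => -[_ <- <-].
by exists a.
Qed.

(** If [phi v] is [m] times [v], applying [phi] three times gives norm 1 for [m]; Hilbert 90 then
    supplies a scalar [k] for which [smul k v] itself is fixed by [phi]. *)
Lemma typeI_ptP v : v != v0 ->
  reflect (exists2 t, t != 0 & pt v = pt (conj_vec t)) (typeI_pt K q (pt v)).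
Proof.
move=> v_n0; apply: (iffP idP) => [|[t t0 ->]]; last first.
  by rewrite /typeI_pt phiS_pt phi_conj_vec.
rewrite /typeI_pt phiS_pt eq_sym => /pt_eq[m m0 Em].
have N1 : norm3 m^-1 = 1.
  suff Nm : norm3 m = 1 by rewrite norm3V Nm invr1.
  have E3 : v = smul (norm3 m) v.
    by rewrite -{1}[v]phi3 Em !phi_smul Em phi_smul Em !smulA /norm3; congr smul; ring.
  case: v v_n0 {Em} E3 => [[a b] c]; rewrite vec_eq0 /smul => abc [Ea Eb Ec].
  have one x : x = norm3 m * x -> x != 0 -> norm3 m = 1.
    by move=> E x0; apply: (mulIf x0); rewrite -E mul1r.
  move: abc; rewrite !negb_and => /or3P[]; exact: one.
have [k k0 Ek] := hilbert90 N1.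
have fixed : phi (smul k v) = smul k v.
  rewrite phi_smul Em smulA; congr smul.
  by rewrite -[fr k](mulfVK k0) -Ek mulrAC mulVf // mul1r.
have [t Et] := phi_fixed fixed.
have t0 : t != 0.
  have : smul k v != v0 by rewrite smul_eq0 (negPf k0).
  by rewrite Et /conj_vec vec_eq0 !fr_eq0; case: (t == 0).
by exists t => //; rewrite -Et pt_smul.
Qed.

(** * Linearized polynomials *)

(** The zeros of the linearized polynomial with coefficients [l], a subspace of K over F_q. The
    nonzero ones parametrize the points of [P2q] on the line [l]. *)
Definition kernel (l : vec) : {set K} := [set t | dot l (conj_vec t) == 0].
Definition span2 (s t : K) : {set K} :=
  [set ab.1 * s + ab.2 * t | ab in setX Fq Fq].

Lemma FqB a b : a \in Fq -> b \in Fq -> a - b \in Fq.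
Proof. by rewrite !inE frB => /eqP-> /eqP->. Qed.
Lemma Fq_div a b : a \in Fq -> b \in Fq -> a / b \in Fq.
Proof. by rewrite !inE frM frV => /eqP-> /eqP->. Qed.

Lemma conj_vec_eq0 t : (conj_vec t == v0) = (t == 0).
Proof. by rewrite vec_eq0 !fr_eq0; case: (t == 0). Qed.

Lemma kernelE d e f t : (t \in kernel (d, e, f)) = (d * t + e * fr t + f * fr (fr t) == 0).
Proof. by rewrite inE. Qed.

Lemma kernel0 l : 0 \in kernel l.
Proof. by case: l => [[d e] f]; rewrite kernelE !fr0 !mulr0 !addr0. Qed.

Lemma dot_conj_vecD l s t :
  dot l (conj_vec (s + t)) = dot l (conj_vec s) + dot l (conj_vec t).
Proof. by case: l => [[d e] f]; rewrite !dotE !frD; ring. Qed.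

Lemma dot_conj_vec_scale l a t : a \in Fq ->
  dot l (conj_vec (a * t)) = a * dot l (conj_vec t).
Proof. by case: l => [[d e] f]; rewrite inE !dotE !frM => /eqP Ha; rewrite !Ha; ring. Qed.

Lemma kernelD l s t : s \in kernel l -> t \in kernel l -> s + t \in kernel l.
Proof. by rewrite !inE dot_conj_vecD => /eqP-> /eqP->; rewrite addr0. Qed.

Lemma kernel_scale l a t : a \in Fq -> t \in kernel l -> a * t \in kernel l.
Proof. by move=> aF; rewrite !inE dot_conj_vec_scale // => /eqP->; rewrite mulr0. Qed.

Lemma kernelB l s t : s \in kernel l -> t \in kernel l -> s - t \in kernel l.
Proof.
move=> Hs Ht; apply: kernelD => //; rewrite -mulN1r; apply: kernel_scale => //.
by rewrite inE frN fr1.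
Qed.

Lemma card_kernel_le l : l != v0 -> (#|kernel l| <= q ^ 2)%N.
Proof. by case: l => [[d e] f] /card_kernel_poly. Qed.

Lemma card_span2 s t : t != 0 -> s / t \notin Fq -> #|span2 s t| = (q ^ 2)%N.
Proof.
move=> t0 st; rewrite card_in_imset; first by rewrite cardsX card_Fq mulnn.
move=> [a b] [c d] /= /setXP[/= aF bF] /setXP[/= cF dF] E.
have E' : (a - c) * s = (d - b) * t.
  by apply/eqP; rewrite -subr_eq0 -(subrr (c * s + d * t)) -{1}E; apply/eqP; ring.
have [ac|ac] := eqVneq a c.
  congr (_, _); first exact: ac.
  move/esym/eqP: E'; rewrite ac subrr mul0r mulf_eq0 (negPf t0) orbF subr_eq0.
  by move/eqP.
have ac0 : a - c != 0 by rewrite subr_eq0.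
case/negP: st; have -> : s / t = (d - b) / (a - c).
  by apply/eqP; rewrite eqr_div // mulrC E'.
by rewrite Fq_div ?FqB.
Qed.

Lemma span2_sub_kernel l s t :
  s \in kernel l -> t \in kernel l -> span2 s t \subset kernel l.
Proof.
move=> Hs Ht; apply/subsetP => _ /imsetP[[a b] /setXP[aF bF] ->].
by apply: kernelD; apply: kernel_scale.
Qed.

(** Two independent zeros span q^2 elements, which already exhausts the degree bound. *)
Lemma kernel_span2 l s t : l != v0 -> t != 0 -> s / t \notin Fq ->
  s \in kernel l -> t \in kernel l -> kernel l = span2 s t.
Proof.
move=> l0 t0 st Hs Ht; apply/esym/eqP.
by rewrite eqEcard span2_sub_kernel //= card_span2 // card_kernel_le.
Qed.

Lemma notin_Fq : exists t, t \notin Fq.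
Proof.
apply/existsP; rewrite -negb_forall; apply/negP => /forallP H.
have : #|Fq| = #|K| by apply: eq_card => x; rewrite H.
by rewrite card_Fq cardK; nia.
Qed.

Lemma notin_span2 s t : exists u, u \notin span2 s t.
Proof.
apply/existsP; rewrite -negb_forall; apply/negP => /forallP H.
have E : #|span2 s t| = #|K| by apply: eq_card => x; rewrite H.
have := leq_imset_card (fun ab : K * K => ab.1 * s + ab.2 * t) (setX Fq Fq).
by rewrite -/(span2 s t) E cardsX card_Fq cardK; nia.
Qed.

(** Provides the quadrangle with parameters 1, [s], [t], [1 + s + t], where 1, [s], [t] are
    independent over F_q. Independence is put in the form in which it is used: no line contains the
    three corresponding points of [P2q]. *)
Lemma independent3 : exists s t : K, [/\ s != 0, t != 0, 1 + s + t != 0 &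
  forall l, l != v0 -> 1 \in kernel l -> s \in kernel l -> t \in kernel l -> False].
Proof.
have [s sF] := notin_Fq; have [t ts] := notin_span2 s 1; exists s, t; split=> //.
- by apply: contraNneq sF => ->; rewrite Fq0.
- apply: contraNneq ts => ->; apply/imsetP; exists (0, 0); last by rewrite /= !mul0r addr0.
  by apply/setXP; rewrite Fq0.
- apply: contraNneq ts => st0; apply/imsetP; exists (- 1, - 1) => /=.
    by apply/setXP; rewrite /= !inE frN fr1.
  by transitivity (1 + s + t - 1 - s); [ring | rewrite st0; ring].
move=> l l0 H1 Hs Ht; case/negP: ts.
by rewrite -(kernel_span2 l0) ?oner_eq0 ?divr1.
Qed.

Lemma coset_Fq_card t : t != 0 ->
  #|[set s in [set x : K | x != 0] | s / t \in Fq]| = (q - 1)%N.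
Proof.
move=> t0; rewrite -card_Fq1 -(card_fr_div_fibre t0); apply: eq_card => s.
rewrite !inE; case: eqVneq => //= s0; by rewrite fr_div_eq // inE.
Qed.

(* The kernel of the trace has at least q^2 elements because the trace takes
   at most q values. *)
Lemma card_kernel_conj_vec m : m != 0 -> #|kernel (conj_vec m)| = (q ^ 2)%N.
Proof.
move=> m0; apply/eqP; rewrite eqn_leq card_kernel_le ?conj_vec_eq0 //=.
pose f t := dot (conj_vec m) (conj_vec t).
have fB s t : f (s - t) = f s - f t by rewrite /f !dotE !frB; ring.
have fib : {in [set: K], forall t, #|[set s in [set: K] | f s == f t]|
                                  = #|kernel (conj_vec m)|}.
  move=> t _; rewrite -(card_imset (kernel (conj_vec m)) (addrI t)).
  apply: eq_card => s; rewrite !inE; apply/idP/imsetP => [st | [r + ->]].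
    by exists (s - t); [rewrite inE -/(f _) fB subr_eq0 | rewrite addrCA subrr addr0].
  by rewrite inE -/(f r) -[f (t + r) == _]subr_eq0 -fB [t + r]addrC addrK.
have := card_fibres fib; rewrite cardsT cardK.
have /subset_leq_card : [set f t | t in [set: K]] \subset Fq.
  apply/subsetP => _ /imsetP[t _ ->].
  by rewrite inE /f dotE !(frD, frM) !fr3; apply/eqP; ring.
rewrite card_Fq => im_le E.
by rewrite -(leq_pmul2l (ltnW q_gt1)) -expnS E leq_mul2r im_le orbT.
Qed.

(** * Orbits off the triangle are planes *)

Definition hmul (u v : vec) : vec := (u.1.1 * v.1.1, u.1.2 * v.1.2, u.2 * v.2).
Definition off (v : vec) : bool := [&& v.1.1 != 0, v.1.2 != 0 & v.2 != 0].
Definition inv_vec (v : vec) : vec := (v.1.1^-1, v.1.2^-1, v.2^-1).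

Local Notation orb v := (orbitST K q (pt v)).

Lemma off_neq0 v : off v -> v != v0.
Proof. by case: v => [[a b] c] /and3P[a0 _ _]; rewrite vec_eq0 (negPf a0). Qed.

Lemma off_inv v : off (inv_vec v) = off v.
Proof. by rewrite /off /= !invr_eq0. Qed.

Lemma off_psi t v : t != 0 -> off (psi t v) = off v.
Proof.
move=> t0; case: v => [[a b] c].
by rewrite psiE /off /= !mulf_eq0 !fr_eq0 (negPf t0).
Qed.

Lemma off_smul t v : t != 0 -> off (smul t v) = off v.
Proof.
by move=> t0; case: v => [[a b] c]; rewrite /off /= !mulf_eq0 (negPf t0).
Qed.

Lemma inv_vecK v : inv_vec (inv_vec v) = v.
Proof. by case: v => [[a b] c]; rewrite /inv_vec /= !invrK. Qed.

Lemma inv_smul k v : inv_vec (smul k v) = smul k^-1 (inv_vec v).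
Proof. by case: v => [[a b] c]; rewrite /inv_vec /smul /= !invfM. Qed.

Lemma inv_psi t v : inv_vec (psi t v) = psi t^-1 (inv_vec v).
Proof. by case: v => [[a b] c]; rewrite /inv_vec !psiE /= !invfM !frV. Qed.

(** The diagonal matrix of [v] is moved onto the line, so that incidence with the orbit of [v]
    becomes membership in a kernel. *)
Lemma dot_psi l t v : dot l (psi t v) = dot (hmul l v) (conj_vec t).
Proof.
case: l v => [[d e] f] [[a b] c].
by rewrite psiE /conj_vec /hmul !dotE /=; ring.
Qed.

Lemma hmul_eq0 l v : off v -> (hmul l v == v0) = (l == v0).
Proof.
case: l v => [[d e] f] [[a b] c] /and3P[/= a0 b0 c0].
by rewrite !vec_eq0 !mulf_eq0 (negPf a0) (negPf b0) (negPf c0) !orbF.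
Qed.

Lemma hmulK l v : off v -> hmul (hmul l v) (inv_vec v) = l.
Proof.
case: l v => [[d e] f] [[a b] c] /and3P[/= a0 b0 c0].
by rewrite /hmul /= !mulfK.
Qed.

Lemma hmul_inv m k v : hmul (smul k (conj_vec m)) (inv_vec v) = smul k (psi m (inv_vec v)).
Proof.
by case: v => [[a b] c]; rewrite psiE /hmul /smul /= !mulrA.
Qed.

Lemma mem_orb v P : reflect (exists2 t, t != 0 & P = pt (psi t v)) (P \in orb v).
Proof.
apply: (iffP imsetP) => -[t]; rewrite ?inE => t0 ->.
  by exists t; rewrite ?psiS_pt.
by exists t; rewrite ?inE ?psiS_pt.
Qed.

Lemma orb_image v : orb v = [set pt (psi t v) | t in [set x : K | x != 0]].
Proof.
apply/setP => P; apply/mem_orb/imsetP => -[t]; rewrite ?inE => t0 ->;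
by exists t; rewrite ?inE.
Qed.

Lemma orb_eq v w :
  reflect (exists k t, [/\ k != 0, t != 0 & w = smul k (psi t v)]) (orb v == orb w).
Proof.
apply: (iffP eqP) => [E | [k [t [k0 t0 ->]]]].
  have : pt w \in orb w by apply/mem_orb; exists 1; rewrite ?oner_eq0 ?psi1.
  rewrite -E => /mem_orb[t t0 /esym/eqP/pt_eq[k k0 Ew]].
  by exists k, t.
apply/setP => P; apply/mem_orb/mem_orb => -[s s0 ->].
  exists (s / t); rewrite ?mulf_neq0 ?invr_eq0 //.
  by rewrite psi_smul pt_smul // psiM mulfVK.
by exists (s * t); rewrite ?mulf_neq0 // psi_smul pt_smul // psiM.
Qed.

Lemma orb_psi t v : t != 0 -> orb (psi t v) = orb v.
Proof. by move=> t0; apply/esym/eqP/orb_eq; exists 1, t; rewrite oner_eq0 smul1. Qed.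

Lemma orb_inv v w : (orb (inv_vec v) == orb (inv_vec w)) = (orb v == orb w).
Proof.
have aux u x : orb u == orb x -> orb (inv_vec u) == orb (inv_vec x).
  case/orb_eq=> k [t [k0 t0 ->]]; apply/orb_eq; exists k^-1, t^-1.
  by rewrite !invr_eq0 inv_smul inv_psi.
apply/idP/idP; last exact: aux.
by move/aux; rewrite !inv_vecK.
Qed.

(** The first two coordinates already force the ratio into F_q. As [c] is free, the statement also
    covers orbits on the side z = 0. *)
Lemma pt_psi_eq a b c s t : a != 0 -> b != 0 -> s != 0 -> t != 0 ->
  (pt (psi s (a, b, c)) == pt (psi t (a, b, c))) = (s / t \in Fq).
Proof.
move=> a0 b0 s0 t0; rewrite inE frM frV !psiE.
apply/pt_eq/eqP => [[k k0 [Ea Eb _]] | E].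
  have {}Ea : t = k * s by apply: (mulIf a0); rewrite Ea mulrA.
  have {}Eb : fr t = k * fr s by apply: (mulIf b0); rewrite Eb mulrA.
  by rewrite Ea -{1}Ea Eb; apply/eqP; rewrite eqr_div ?mulf_neq0 ?fr_eq0 //; apply/eqP; ring.
have E1 : fr (s / t) = s / t by rewrite frM frV.
have ts : t = t / s * s by rewrite mulfVK.
have E2 : fr (t / s) = t / s by rewrite -invf_div frV E1.
exists (t / s); first by rewrite mulf_neq0 ?invr_eq0.
have ft : fr t = t / s * fr s by rewrite {1}ts frM E2.
have fft : fr (fr t) = t / s * fr (fr s) by rewrite {1}ft frM E2.
by rewrite smulE !mulrA -ts -ft -fft.
Qed.

Lemma card_orb a b c : a != 0 -> b != 0 -> #|orb (a, b, c)| = (q ^ 2 + q + 1)%N.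
Proof.
move=> a0 b0; rewrite orb_image.
have fib : {in [set x : K | x != 0], forall t,
    #|[set s in [set x : K | x != 0] | pt (psi s (a, b, c)) == pt (psi t (a, b, c))]|
      = (q - 1)%N}.
  move=> t; rewrite inE => t0; rewrite -(coset_Fq_card t0); apply: eq_card => s.
  by rewrite !inE; case: eqVneq => //= s0; rewrite pt_psi_eq // inE.
have := card_fibres fib; rewrite cardK1 => /eqP.
by rewrite eqn_pmul2r ?subn_gt0 // => /eqP <-.
Qed.

(** Each common point comes from the q - 1 nonzero zeros in one coset of the multiplicative group of
    F_q; the successor accounts for the zero t = 0. *)
Lemma nmeet_orb l v : off v ->
  (nmeet K (orb v) (pt l) * (q - 1)).+1 = #|kernel (hmul l v)|.
Proof.
case: v => [[a b] c] o; have /and3P[/= a0 b0 c0] := o.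
rewrite (cardsD1 0) kernel0 add1n; congr _.+1.
set v := (a, b, c); set A := kernel _ :\ 0.
have -> : nmeet K (orb v) (pt l) = #|[set pt (psi t v) | t in A]|.
  apply: eq_card => P; rewrite inE; apply/andP/imsetP => [[/mem_orb[t t0 ->]] | [t + ->]].
    by rewrite incident_pt dot_psi => lt; exists t => //; rewrite !inE t0.
  rewrite !inE => /andP[t0 lt]; rewrite incident_pt dot_psi; split=> //.
  by apply/mem_orb; exists t.
apply/esym/card_fibres => t; rewrite !inE => /andP[t0 lt].
rewrite -(coset_Fq_card t0); apply: eq_card => s; rewrite !inE.
case: eqVneq => //= s0; rewrite pt_psi_eq // inE.
apply: andb_idl => st; rewrite -[s](mulfVK t0).
by have := @kernel_scale (hmul l v) (s / t) t; rewrite !inE; apply.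
Qed.

Lemma secant_orb l v : off v -> l != v0 -> secant K (orb v) (pt l) ->
  exists s t, [/\ s \in kernel (hmul l v), t \in kernel (hmul l v), t != 0 & s / t \notin Fq].
Proof.
case: v => [[a b] c] o l0; have /and3P[/= a0 b0 c0] := o.
case/card_gt1P=> P [R []]; rewrite !inE.
case/andP=> /mem_orb[s s0 ->] + /andP[/mem_orb[t t0 ->]].
rewrite !incident_pt !dot_psi pt_psi_eq // => ls lt st.
by exists s, t; split=> //; rewrite inE.
Qed.

Lemma card_kernel_secant l v : off v -> l != v0 -> secant K (orb v) (pt l) ->
  #|kernel (hmul l v)| = (q ^ 2)%N.
Proof.
move=> o l0 /(secant_orb o l0)[s [t [ls lt t0 st]]].
by rewrite (kernel_span2 _ t0 st ls lt) ?hmul_eq0 // card_span2.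
Qed.

Lemma nmeet_of_card_kernel l v : off v ->
  #|kernel (hmul l v)| = (q ^ 2)%N -> nmeet K (orb v) (pt l) = q.+1.
Proof.
move=> o; rewrite -(nmeet_orb _ o) => E.
have : (nmeet K (orb v) (pt l) * (q - 1) == q.+1 * (q - 1))%N by apply/eqP; nia.
by rewrite eqn_pmul2r ?subn_gt0 // => /eqP.
Qed.

Lemma Fq_plane_orb v : off v -> Fq_plane K q (orb v).
Proof.
move=> o; apply/and4P; split.
- apply/subsetP => _ /mem_orb[t t0 ->]; apply/PGpointsP; exists (psi t v) => //.
  by rewrite psi_eq0 ?off_neq0.
- apply/forall_inP => _ /PGlinesP[l l0 ->]; apply/forall_inP => _ /PGlinesP[m m0 ->].
  apply/implyP => /and3P[sl sm _].
  have cl := card_kernel_secant o l0 sl; have cm := card_kernel_secant o m0 sm.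
  (* Pigeonhole: the two kernels give q^4 pairs but K has only q^3 elements, so two distinct pairs
     have equal difference. Then [x1 - y1 = x2 - y2] is a nonzero element of both kernels and
     parametrizes the meeting point. *)
  pose f (xy : K * K) := xy.1 - xy.2.
  have : ~~ dinjectiveb f (setX (kernel (hmul l v)) (kernel (hmul m v))).
    apply/negP => /dinjectiveP inj.
    have := card_in_imset inj.
    have := max_card (mem (f @: setX (kernel (hmul l v)) (kernel (hmul m v)))).
    by rewrite cardsX cl cm cardK => + E; rewrite E; nia.
  case/dinjectivePn=> -[x1 x2] /setXP[/= x1l x2m] [[y1 y2]].
  rewrite inE /= => /andP[nxy /setXP[/= y1l y2m]] E.
  have E12 : x1 - y1 = x2 - y2.
    have {}E : x1 - x2 = y1 - y2 := E.
    by transitivity (x1 - x2 + x2 - y1); [ring | rewrite E; ring].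
  have d0 : x1 - y1 != 0.
    apply: contraNneq nxy => d0; rewrite -(subr0_eq d0).
    by move: d0; rewrite E12 => /subr0_eq ->.
  apply/exists_inP; exists (pt (psi (x1 - y1) v)); first by apply/mem_orb; exists (x1 - y1).
  have := kernelB x1l y1l; have := kernelB x2m y2m; rewrite -E12 !inE.
  by rewrite !incident_pt !dot_psi => -> ->.
- apply/forall_inP => _ /PGlinesP[l l0 ->]; apply/implyP => sl.
  by apply/eqP/nmeet_of_card_kernel => //; apply: card_kernel_secant.
have [s [t [s0 t0 u0 ind]]] := independent3.
have noncol x y z : (forall l, l != v0 -> x \in kernel l -> y \in kernel l ->
    z \in kernel l -> False) -> ~~ collinear K (pt (psi x v)) (pt (psi y v)) (pt (psi z v)).
  move=> H; apply/exists_inP => -[_ /PGlinesP[l l0 ->]].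
  rewrite !incident_pt !dot_psi => /and3P[lx ly lz].
  by apply: (H (hmul l v)); rewrite ?hmul_eq0 // inE.
have kers l := (kernelB (l := l)).
apply/exists_inP; exists (pt (psi 1 v)); first by apply/mem_orb; exists 1; rewrite ?oner_eq0.
apply/exists_inP; exists (pt (psi s v)); first by apply/mem_orb; exists s.
apply/exists_inP; exists (pt (psi t v)); first by apply/mem_orb; exists t.
apply/exists_inP; exists (pt (psi (1 + s + t) v)).
  by apply/mem_orb; exists (1 + s + t).
(* Kernels are closed under differences, so any three of the four parameters recover 1, [s] and
   [t]. *)
apply/and4P; split; apply: noncol => l l0 H1 H2 H3; apply: (ind l) => //.
- have -> : t = (1 + s + t) - 1 - s by ring.
  by rewrite !kers.
- have -> : s = (1 + s + t) - 1 - t by ring.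
  by rewrite !kers.
have -> : 1 = (1 + s + t) - s - t :> K by ring.
by rewrite !kers.
Qed.

Lemma cross_conj_vec s t :
  cross (conj_vec s) (conj_vec t) = conj_vec (fr s * fr (fr t) - fr (fr s) * fr t).
Proof.
by rewrite /cross /conj_vec /= !(frD, frN, frM) !fr3; congr (_, _, _); ring.
Qed.

Lemma cross_conj_vec_neq0 s t : t != 0 -> s / t \notin Fq ->
  cross (conj_vec s) (conj_vec t) != v0.
Proof.
move=> t0; apply: contraNneq => E.
move/eqP: E; rewrite cross_conj_vec conj_vec_eq0 subr_eq0 -!frM (inj_eq fr_inj).
by move=> E; rewrite inE frM frV eqr_div ?fr_eq0 // eq_sym.
Qed.

(** [hmul l v] is orthogonal to two independent fixed vectors, hence proportional to their cross
    product, which is again fixed by [phi]. Undoing the diagonal matrix by [hmulK] places [l] in the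
    orbit of [inv_vec v]. *)
Lemma secant_line l v : off v -> l != v0 -> secant K (orb v) (pt l) ->
  pt l \in orb (inv_vec v).
Proof.
move=> o l0 /(secant_orb o l0)[s [t [ls lt t0 st]]].
have c0 := cross_conj_vec_neq0 t0 st.
move: ls lt; rewrite !inE => /eqP ls /eqP lt.
have [k E] := cross_unique c0 ls lt.
move: E c0; rewrite cross_conj_vec; set m := _ - _ => E; rewrite conj_vec_eq0 => m0.
have El : l = smul k (psi m (inv_vec v)) by rewrite -hmul_inv -E hmulK.
have k0 : k != 0 by apply: contraNneq l0 => k0; rewrite El k0 smul_eq0 eqxx.
by apply/mem_orb; exists m => //; rewrite El pt_smul.
Qed.

Lemma hmul_psi_inv m v : off v -> hmul (psi m (inv_vec v)) v = conj_vec m.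
Proof.
case: v => [[a b] c] /and3P[/= a0 b0 c0].
by rewrite /hmul psiE /= !mulfVK.
Qed.

(** The lines of the orbit plane are exactly the members of the orbit of [inv_vec v]: one inclusion
    is [secant_line], the other holds because the pulled-back line is some [conj_vec m], whose
    kernel has q^2 elements. *)
Lemma all_lines_orb pr v : off v ->
  all_lines_of K q pr (orb v) = all_pts K pr (orb (inv_vec v)).
Proof.
move=> o; apply/forall_inP/forall_inP => [H _ /mem_orb[m m0 ->] | H _ /PGlinesP[l l0 ->]].
  have n0 : psi m (inv_vec v) != v0 by rewrite psi_eq0 // off_neq0 ?off_inv.
  apply: (implyP (H _ _)); first by apply/PGlinesP; exists (psi m (inv_vec v)).
  by apply/eqP/nmeet_of_card_kernel; rewrite // hmul_psi_inv ?card_kernel_conj_vec.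
apply/implyP => /eqP E; apply/H/secant_line => //.
by rewrite /secant E ltnS ltnW.
Qed.

(** * Types of whole orbits and the effect of inverting coordinates *)

Lemma P2qE : P2q K q = orb (1, 1, 1).
Proof.
apply/setP => P; apply/imsetP/mem_orb => -[t]; rewrite ?inE => t0 ->.
  by exists t => //; rewrite psiE !mulr1 frq2E.
by exists t; rewrite ?inE // psiE !mulr1 frq2E.
Qed.

Lemma typeI_psi t v : t != 0 -> typeI_pt K q (pt (psi t v)) = typeI_pt K q (pt v).
Proof.
move=> t0; rewrite /typeI_pt !phiS_pt phi_psi; apply/pt_eq/pt_eq => -[k k0 E]; exists k => //.
  by have := congr1 (psi t^-1) E; rewrite psi_smul !psiM mulVf // !psi1.
by rewrite {1}E psi_smul.
Qed.

Lemma typeII_psi t v : t != 0 -> v != v0 ->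
  typeII_pt K q (pt (psi t v)) = typeII_pt K q (pt v).
Proof.
move=> t0 v_n0; rewrite !typeII_ptE ?psi_eq0 // typeI_psi // orbit_det_psi.
by rewrite mulf_eq0 norm3_eq0 (negPf t0).
Qed.

Lemma typeIII_psi t v : t != 0 -> v != v0 ->
  typeIII_pt K q (pt (psi t v)) = typeIII_pt K q (pt v).
Proof.
move=> t0 v_n0; rewrite !typeIII_ptE ?psi_eq0 // typeI_psi // orbit_det_psi.
by rewrite mulf_eq0 norm3_eq0 (negPf t0).
Qed.

Lemma all_pts_orb pr v : (forall t, t != 0 -> pr (pt (psi t v)) = pr (pt v)) ->
  all_pts K pr (orb v) = pr (pt v).
Proof.
move=> H; apply/forall_inP/idP => [Hv | prv _ /mem_orb[t t0 ->]]; last by rewrite H.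
by rewrite -(H 1) ?oner_eq0 // Hv //; apply/mem_orb; exists 1; rewrite ?oner_eq0.
Qed.

Lemma all_typeI_orb v : all_pts K (typeI_pt K q) (orb v) = typeI_pt K q (pt v).
Proof. by apply: all_pts_orb => t; apply: typeI_psi. Qed.
Lemma all_typeII_orb v : v != v0 ->
  all_pts K (typeII_pt K q) (orb v) = typeII_pt K q (pt v).
Proof. by move=> v_n0; apply: all_pts_orb => t t0; apply: typeII_psi. Qed.
Lemma all_typeIII_orb v : v != v0 ->
  all_pts K (typeIII_pt K q) (orb v) = typeIII_pt K q (pt v).
Proof. by move=> v_n0; apply: all_pts_orb => t t0; apply: typeIII_psi. Qed.

Lemma lines_typeII_orb v : off v ->
  all_lines_of K q (typeII_ln K q) (orb v) = typeII_pt K q (pt (inv_vec v)).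
Proof.
move=> o; have i0 : inv_vec v != v0 by rewrite off_neq0 ?off_inv.
rewrite all_lines_orb // -all_typeII_orb //.
by apply/forall_inP/forall_inP => H P PO; have [t t0 E] := mem_orb _ _ PO;
   have := H P PO; rewrite E typeII_lnE.
Qed.

Lemma lines_typeIII_orb v : off v ->
  all_lines_of K q (typeIII_ln K q) (orb v) = typeIII_pt K q (pt (inv_vec v)).
Proof.
move=> o; have i0 : inv_vec v != v0 by rewrite off_neq0 ?off_inv.
rewrite all_lines_orb // -all_typeIII_orb //.
by apply/forall_inP/forall_inP => H P PO; have [t t0 E] := mem_orb _ _ PO;
   have := H P PO; rewrite E typeIII_lnE.
Qed.

Lemma typeI_off v : v != v0 -> typeI_pt K q (pt v) -> off v.
Proof.
move=> v_n0 /(typeI_ptP v_n0)[t t0 /esym/eqP/pt_eq[k k0 ->]].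
by rewrite off_smul // /off /= !fr_eq0 t0.
Qed.

Lemma conj_vec_psi t : conj_vec t = psi t (1, 1, 1).
Proof. by rewrite psiE !mulr1. Qed.

Lemma typeI_orb v : v != v0 -> typeI_pt K q (pt v) = (orb v == P2q K q).
Proof.
move=> v_n0; rewrite P2qE eq_sym.
apply/(typeI_ptP v_n0)/orb_eq => [[t t0 /eqP]| [k [t [k0 t0 ->]]]].
  by rewrite eq_sym => /pt_eq[k k0 ->]; exists k, t; rewrite -conj_vec_psi.
by exists t => //; rewrite pt_smul // -conj_vec_psi.
Qed.

(** Type I characterizes the orbit of (1, 1, 1), and this vector is its own inverse. *)
Lemma typeI_inv v : off v -> typeI_pt K q (pt (inv_vec v)) = typeI_pt K q (pt v).
Proof.
move=> o; rewrite !typeI_orb ?off_neq0 ?off_inv // P2qE -orb_inv inv_vecK.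
by rewrite /inv_vec /= invr1.
Qed.

Lemma orbit_det_inv_typeI v : off v -> orbit_det v = 0 -> orbit_det (inv_vec v) = 0 ->
  typeI_pt K q (pt v).
Proof.
case: v => [[a b] c] /and3P[/= a0 b0 c0].
rewrite /orbit_det /inv_vec /= !norm3V !frV.
set A := norm3 a; set B := norm3 b; set C := norm3 c.
rewrite -!invfM; set u := a * fr b * fr (fr c).
rewrite /tr3 !frV => E1 E2.
have u0 : u != 0 by rewrite !mulf_neq0 ?fr_eq0.
have [A0 B0 C0] : [/\ A != 0, B != 0 & C != 0] by rewrite !norm3_eq0.
have E3 : u * fr u * fr (fr u) = A * B * C.
  by rewrite /u /A /B /C /norm3 !frM !fr3; ring.
(* The equation for the inverses is multiplied by A B C, which is the norm of [u] by [E3]; this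
   compares the second symmetric functions. *)
have E4 : A * B + B * C + C * A = u * fr u + fr u * fr (fr u) + fr (fr u) * u.
  transitivity (A * B * C * (A^-1 + B^-1 + C^-1)); first by field; rewrite A0 B0 C0.
  move/eqP: E2; rewrite subr_eq0 => /eqP ->; rewrite -E3.
  by field; rewrite !fr_eq0 u0.
have {}E1 : A + B + C = u + fr u + fr (fr u) by apply/eqP; rewrite -subr_eq0 E1.
have char_poly x : (x - A) * (x - B) * (x - C) = (x - u) * (x - fr u) * (x - fr (fr u)).
  transitivity (x ^+ 3 - (A + B + C) * x ^+ 2 + (A * B + B * C + C * A) * x - A * B * C).
    by ring.
  by rewrite E1 E4 -E3; ring.
(* As a root, [u] equals one of the norms A, B, C, all fixed by Frobenius. The polynomial is then (X
   - u)^3, so every one of the norms equals [u]. *)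
have fru : fr u = u.
  have := char_poly u; rewrite subrr !mul0r => /eqP.
  by rewrite !mulf_eq0 !subr_eq0 => /orP[/orP[]|] /eqP ->; apply: fr_norm3.
have root3 x : (x - A) * (x - B) * (x - C) = 0 -> x = u.
  by rewrite char_poly !fru => /eqP; rewrite !mulf_eq0 !orbb subr_eq0 => /eqP.
have Au : A = u by apply: root3; rewrite subrr !mul0r.
have Cu : C = u by apply: root3; rewrite subrr mulr0.
(* Cancelling [a] in u = N a and [fr (fr c)] in u = N c gives the two relations that make [phi v]
   the multiple of [v] by [fr c / a]. *)
have Eba : b * fr c = a * fr a.
  by apply: fr_inj; apply: (mulfI a0); rewrite !frM !mulrA -/u -Au.
have Eab : a * fr b = c * fr c.
  by apply: (mulIf (x := fr (fr c))); rewrite ?fr_eq0 // -/u -Cu.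
rewrite /typeI_pt phiS_pt eq_sym; apply/pt_eq; exists (fr c / a).
  by rewrite mulf_neq0 ?fr_eq0 ?invr_eq0.
rewrite phiE smulE; congr (_, _, _).
- by rewrite mulfVK.
- by rewrite mulrAC [fr c * b]mulrC Eba mulrC mulKf.
by rewrite mulrAC [fr c * c]mulrC -Eab mulrC mulKf.
Qed.

(** Together with [lines_typeIII_orb], this shows that an orbit of Type II points has only Type III
    lines. *)
Lemma typeII_inv v : off v -> typeII_pt K q (pt v) -> typeIII_pt K q (pt (inv_vec v)).
Proof.
move=> o; rewrite typeII_ptE ?off_neq0 // typeIII_ptE ?off_neq0 ?off_inv //.
rewrite typeI_inv // => /andP[nI /eqP D0]; rewrite nI /=.
by apply: contra nI => /eqP D1; apply: orbit_det_inv_typeI.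
Qed.

(* For l orthogonal to the orbit of v under phi, the fixed vectors
   k l + phi (k l) + phi (phi (k l)) are orthogonal to v, and they do not all
   vanish. *)
Lemma orbit_det_eq0 v : v != v0 -> orbit_det v = 0 ->
  exists2 m, m != 0 & dot (conj_vec m) v = 0.
Proof.
move=> v_n0 D0.
have : dot (cross v (phi v)) (phi (phi v)) = 0.
  rewrite -D0; case: v {v_n0 D0} => [[a b] c]; rewrite /orbit_det /tr3 /norm3 !phiE /dot /cross /=.
  by rewrite !frM !fr3; ring.
case/(det_eq0P _ _ v_n0)=> l [l0 lv0 lv1 lv2].
have l1v : dot (phi l) v = 0 by rewrite -[v]phi3 dot_phi lv2 fr0.
have l2v : dot (phi (phi l)) v = 0 by rewrite -[v]phi3 !dot_phi lv1 !fr0.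
case: l l0 lv0 {lv1 lv2} l1v l2v => [[l1 l2] l3] l0 lv0 l1v l2v.
(* As a function of [k], the first coordinate of the fixed vector is the linearized polynomial with
   these coefficients. It is not zero, so some [k] outside its kernel gives a nonzero [m]. *)
have /card_kernel_le : (l1, fr l3, fr (fr l2)) != v0.
  by move: l0; rewrite !vec_eq0 !fr_eq0 [(l3 == 0) && _]andbC.
set ll := (_, _, _) => le.
have [k] : exists k, k \notin kernel ll.
  apply/existsP; rewrite -negb_forall; apply/negP => /forallP H.
  have E : #|kernel ll| = #|K| by apply: eq_card => x; rewrite H.
  by move: le; rewrite E cardK; nia.
rewrite inE; set m := dot _ _ => m0; exists m => //.
case: v lv0 l1v l2v {v_n0 D0} => [[a b] c]; rewrite !phiE !dotE => H0 H1 H2.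
transitivity (k * (l1 * a + l2 * b + l3 * c) + fr k * (fr l3 * a + fr l1 * b + fr l2 * c) +
   fr (fr k) * (fr (fr l2) * a + fr (fr l3) * b + fr (fr l1) * c)); last first.
  by rewrite H0 H1 H2; ring.
by rewrite /m /ll /conj_vec !dotE !(frD, frM) !fr3; ring.
Qed.

(** Two distinct lines fixed by [phi] meet in a point fixed by [phi], so a point not of Type I lies
    on at most one. *)
Lemma conj_line_unique v m n : v != v0 -> ~~ typeI_pt K q (pt v) -> n != 0 ->
  dot (conj_vec m) v = 0 -> dot (conj_vec n) v = 0 -> m / n \in Fq.
Proof.
move=> v_n0 nI n0 mv nv; apply: contraNT nI => mn.
have c0 := cross_conj_vec_neq0 n0 mn; rewrite dotC in mv; rewrite dotC in nv.
have [k E] := cross_unique c0 mv nv; move: E c0; rewrite cross_conj_vec => E.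
rewrite conj_vec_eq0 => r0; apply/(typeI_ptP v_n0); eexists; first exact: r0.
by rewrite {1}E pt_smul //; apply: contraNneq v_n0 => k0; rewrite E k0 smul_eq0 eqxx.
Qed.

(** * Counting the planes *)

Lemma orbSTP O : reflect (exists2 v, v != v0 & O = orb v) (O \in orbST K q).
Proof.
apply: (iffP imsetP) => [[_ /PGpointsP[v v_n0 ->] ->]|[v v_n0 ->]]; first by exists v.
by exists (pt v) => //; apply/PGpointsP; exists v.
Qed.

(** With a zero coordinate the whole orbit lies on a side of the triangle and contains no
    quadrangle. *)
Lemma Fq_plane_off v : v != v0 -> Fq_plane K q (orb v) -> off v.
Proof.
move=> v_n0 /and4P[_ _ _ quad]; apply: contraLR quad => noff.
have [l l0 lv] : exists2 l, l != v0 & forall t, dot l (psi t v) = 0.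
  case: v {v_n0} noff => [[a b] c]; rewrite /off !negb_and !negbK => /or3P[]/eqP /= ->;
  [exists (1, 0, 0) | exists (0, 1, 0) | exists (0, 0, 1)];
  rewrite ?vec_eq0 ?oner_eq0 ?andbF // => t; rewrite psiE dotE; ring.
apply/exists_inP => -[_ /mem_orb[t1 _ ->]] /exists_inP[_ /mem_orb[t2 _ ->]].
case/exists_inP=> _ /mem_orb[t3 _ ->] /exists_inP[_ _ /and4P[/negP[]]].
apply/exists_inP; exists (pt l); first by apply/PGlinesP; exists l.
by rewrite !incident_pt !lv !eqxx.
Qed.

Definition plane_class (ptI lnI : {set vec} -> bool) : {set {set {set vec}}} :=
  [set O in orbST K q |
    [&& Fq_plane K q O, all_pts K ptI O & all_lines_of K q lnI O]].

Definition vec1 (b c : K) : vec := (1, b, c).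
(** Normal form for Type II orbits off the triangle: a point of the fixed line x + y + z = 0, scaled
    to first coordinate 1. *)
Definition zero_sum_vec (y : K) : vec := vec1 y (- (1 + y)).
Definition zero_sum_params : {set K} :=
  [set y | [&& y != 0, 1 + y != 0 & ~~ typeI_pt K q (pt (zero_sum_vec y))]].

Lemma off_zero_sum y : off (zero_sum_vec y) = (y != 0) && (1 + y != 0).
Proof. by rewrite /off /= oner_eq0 oppr_eq0. Qed.

Lemma zero_sum_dot y : dot (conj_vec 1) (zero_sum_vec y) = 0.
Proof. by rewrite /conj_vec dotE !fr1; ring. Qed.

Lemma zero_sum_vec_neq0 y : zero_sum_vec y != v0.
Proof. by rewrite vec_eq0 oner_eq0. Qed.

Lemma zero_sum_typeII y : y \in zero_sum_params -> typeII_pt K q (pt (zero_sum_vec y)).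
Proof.
rewrite inE => /and3P[_ _ nI]; rewrite typeII_ptE ?zero_sum_vec_neq0 // nI /=.
rewrite /orbit_det /norm3 /tr3 /=.
by apply/eqP; rewrite !(frN, frD, frM, fr1, fr3); ring.
Qed.

Lemma dot_conj_vec_psi m v : dot (conj_vec m) v = dot (conj_vec 1) (psi m v).
Proof.
by case: v => [[a b] c]; rewrite /conj_vec psiE !dotE !fr1 !mul1r.
Qed.

(** A Type II point lies on some fixed line [conj_vec m], and [psi m] carries it to a point of x + y
    + z = 0. *)
Lemma orb_zero_sum v : off v -> typeII_pt K q (pt v) ->
  exists2 y, y \in zero_sum_params & orb v = orb (zero_sum_vec y).
Proof.
move=> o; have v_n0 := off_neq0 o.
rewrite typeII_ptE // => /andP[nI /eqP /(orbit_det_eq0 v_n0)[m m0]].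
rewrite dot_conj_vec_psi; set w := psi m v.
have ow : off w by rewrite off_psi.
have nIw : ~~ typeI_pt K q (pt w) by rewrite typeI_psi.
have -> : orb v = orb w by rewrite orb_psi.
case: w ow nIw => [[a b] c] ow nIw; have /and3P[/= a0 b0 c0] := ow.
rewrite /conj_vec dotE !fr1 !mul1r => abc.
have Ew : (a, b, c) = smul a (zero_sum_vec (b / a)).
  rewrite smulE; congr (_, _, _); rewrite ?mulr1 //.
    by rewrite mulrC mulfVK.
  rewrite mulrN mulrDr mulr1 [a * _]mulrC mulfVK //.
  by transitivity (a + b + c - (a + b)); [ring | rewrite abc sub0r].
have Ept : pt (a, b, c) = pt (zero_sum_vec (b / a)) by rewrite Ew pt_smul.
exists (b / a); last by rewrite Ept.
by rewrite inE andbA -off_zero_sum -(off_smul _ a0) -Ew ow -Ept nIw.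
Qed.

(** If [psi t] keeps the point on x + y + z = 0, the point lies on the fixed lines [conj_vec t] and
    [conj_vec 1]. Uniqueness puts [t] in F_q, so [psi t] acts as a scalar. *)
Lemma orb_zero_sum_inj : {in zero_sum_params &, injective (fun y => orb (zero_sum_vec y))}.
Proof.
move=> y z; rewrite !inE => /and3P[y0 y1 nI] _ /eqP/orb_eq[k [t [k0 t0 E]]].
have : dot (conj_vec t) (zero_sum_vec y) = 0.
  apply: (mulfI k0); rewrite mulr0 dot_conj_vec_psi -dot_smulr -E; exact: zero_sum_dot.
move=> /(@conj_line_unique _ t 1 (zero_sum_vec_neq0 y) nI (oner_neq0 _)).
move=> /(_ (zero_sum_dot y)); rewrite divr1 inE => /eqP ft.
move: E; rewrite psiE !ft smulE mulr1 => -[kt -> _].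
by rewrite mulrA -kt mul1r.
Qed.

(** Of the q^3 values of y, two (0 and -1) put the point on the triangle and q + 1 give a point of
    [P2q]. *)
Lemma card_zero_sum_params : (#|zero_sum_params| + (q.+1 + 2) = q ^ 3)%N.
Proof.
pose E := [set y : K | (y != 0) && (1 + y != 0)].
pose X := [set y : K | typeI_pt K q (pt (zero_sum_vec y))].
have XE : X \subset E.
  by apply/subsetP => y; rewrite !inE -off_zero_sum; apply: typeI_off; apply: zero_sum_vec_neq0.
have cE : (#|E| + 2 = q ^ 3)%N.
  rewrite -cardK -(cardsC E); congr (_ + _)%N.
  have -> : ~: E = [set 0; -1].
    by apply/setP => y; rewrite !inE negb_and !negbK [1 + y]addrC addr_eq0.
  by rewrite cards2 eq_sym oppr_eq0 oner_eq0.
have cX : #|X| = q.+1.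
  have o1 : off (1, 1, 1) by rewrite /off /= oner_eq0.
  (* The q + 1 is obtained as the number of points of [P2q] on the line [1, 1, 1], whose kernel
     consists of the elements of trace 0. *)
  rewrite -(@nmeet_of_card_kernel (1, 1, 1) (1, 1, 1)) //; last first.
    rewrite -(@card_kernel_conj_vec 1) ?oner_eq0 //.
    by rewrite /hmul /conj_vec /= !fr1 mulr1.
  have inj : injective (fun y => pt (zero_sum_vec y)).
    move=> y z /eqP/pt_eq[k _]; rewrite smulE => -[].
    by rewrite mulr1 => <-; rewrite mul1r.
  rewrite -(card_imset _ inj); apply: eq_card => P; rewrite inE.
  apply/imsetP/andP => [[y + ->] | []].
    rewrite inE typeI_orb ?zero_sum_vec_neq0 // P2qE => /eqP <-; split.
      by apply/mem_orb; exists 1; rewrite ?oner_eq0 ?psi1.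
    by rewrite incident_pt; apply/eqP; rewrite -[RHS](zero_sum_dot y) /conj_vec !fr1.
  case/mem_orb=> t t0 ->; rewrite incident_pt -conj_vec_psi dotE !mul1r => /eqP tr0.
  have Et : conj_vec t = smul t (zero_sum_vec (fr t / t)).
    rewrite smulE /conj_vec; congr (_, _, _); rewrite ?mulr1 //.
      by rewrite mulrC mulfVK.
    rewrite mulrN mulrDr mulr1 [t * _]mulrC mulfVK //.
    by transitivity (t + fr t + fr (fr t) - (t + fr t)); [ring | rewrite tr0 sub0r].
  exists (fr t / t); last by rewrite Et pt_smul.
  by rewrite inE -(pt_smul _ t0) -Et /typeI_pt phiS_pt phi_conj_vec.
have -> : zero_sum_params = E :\: X.
  by apply/setP => y; rewrite !inE andbA andbC.
by rewrite cardsD (setIidPr XE) cX; have := subset_leq_card XE; rewrite cX; lia.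
Qed.

Lemma typeII_III v : typeII_pt K q (pt v) -> ~~ typeIII_pt K q (pt v).
Proof. by case/andP=> _ c; rewrite /typeIII_pt c andbF. Qed.

Lemma type_cases v : [|| typeI_pt K q (pt v), typeII_pt K q (pt v) | typeIII_pt K q (pt v)].
Proof. by rewrite /typeII_pt /typeIII_pt /typeI_pt; case: (_ == _) => //=; case: collinear. Qed.

Lemma planes_II_III :
  plane_class (typeII_pt K q) (typeIII_ln K q)
    = [set orb (zero_sum_vec y) | y in zero_sum_params].
Proof.
apply/setP => O; apply/idP/imsetP => [|[y yY ->]].
  rewrite inE => /andP[/orbSTP[v v_n0 ->] /and3P[/(Fq_plane_off v_n0) o]].
  by rewrite all_typeII_orb // => H _; apply: orb_zero_sum.
have o : off (zero_sum_vec y) by rewrite off_zero_sum; move: yY; rewrite inE; case/and3P=> -> ->.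
have n0 := off_neq0 o; have H := zero_sum_typeII yY.
rewrite inE Fq_plane_orb // all_typeII_orb // lines_typeIII_orb // H typeII_inv //.
by rewrite !andbT; apply/orbSTP; exists (zero_sum_vec y).
Qed.

Lemma planes_III_II :
  plane_class (typeIII_pt K q) (typeII_ln K q)
    = [set orb (inv_vec (zero_sum_vec y)) | y in zero_sum_params].
Proof.
apply/setP => O; apply/idP/imsetP => [|[y yY ->]].
  rewrite inE => /andP[/orbSTP[v v_n0 ->] /and3P[/(Fq_plane_off v_n0) o _]].
  rewrite lines_typeII_orb // => H.
  have [|y yY E] := orb_zero_sum _ H; first by rewrite off_inv.
  by exists y => //; apply/eqP; rewrite -orb_inv inv_vecK E.
have o : off (zero_sum_vec y) by rewrite off_zero_sum; move: yY; rewrite inE; case/and3P=> -> ->.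
have H := zero_sum_typeII yY.
have oi : off (inv_vec (zero_sum_vec y)) by rewrite off_inv.
have n0 := off_neq0 oi.
rewrite inE Fq_plane_orb // all_typeIII_orb // lines_typeII_orb // inv_vecK H typeII_inv //.
by rewrite !andbT; apply/orbSTP; exists (inv_vec (zero_sum_vec y)).
Qed.

Lemma card_planes_II_III :
  #|plane_class (typeII_pt K q) (typeIII_ln K q)| = #|zero_sum_params|.
Proof. by rewrite planes_II_III card_in_imset //; apply: orb_zero_sum_inj. Qed.

Lemma card_planes_III_II :
  #|plane_class (typeIII_pt K q) (typeII_ln K q)| = #|zero_sum_params|.
Proof.
rewrite planes_III_II card_in_imset // => y z yY zY /eqP.
by rewrite orb_inv => /eqP; apply: orb_zero_sum_inj.
Qed.

(** * All orbits off the triangle, and the planes with Type III points and lines *)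

Definition off_orbits : {set {set {set vec}}} :=
  [set orb (vec1 bc.1 bc.2) | bc in setX [set x : K | x != 0] [set x : K | x != 0]].

Lemma off_orbitsP O : reflect (exists2 v, off v & O = orb v) (O \in off_orbits).
Proof.
apply: (iffP imsetP) => [[[b c] /setXP[]] | [[[a b] c] /and3P[/= a0 b0 c0] ->]].
  rewrite !inE => b0 c0 ->; exists (vec1 b c) => //.
  by rewrite /off /= oner_eq0 b0.
exists (b / a, c / a).
  by apply/setXP; rewrite !inE !mulf_neq0 ?invr_eq0.
apply/eqP/orb_eq; exists a^-1, 1; rewrite invr_eq0 oner_eq0 psi1; split=> //.
by rewrite smulE mulVf //= ![a^-1 * _]mulrC.
Qed.

(** There are (q^3 - 1)^2 vectors with first coordinate 1 off the triangle. Each orbit contains q^2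
    + q + 1 of them, one for each of its points. *)
Lemma card_off_orbits : #|off_orbits| = ((q ^ 2 + q + 1) * (q - 1) ^ 2)%N.
Proof.
set D := setX [set x : K | x != 0] [set x : K | x != 0].
have fib : {in D, forall x, #|[set y in D | orb (vec1 y.1 y.2) == orb (vec1 x.1 x.2)]|
   = (q ^ 2 + q + 1)%N}.
  move=> [b c] /setXP[]; rewrite !inE /= => b0 c0.
  rewrite -(@card_orb 1 b c) ?oner_eq0 //.
  pose f (y : K * K) := pt (vec1 y.1 y.2).
  have inj : injective f.
    move=> [y1 y2] [z1 z2] /eqP/pt_eq[k _]; rewrite smulE => -[].
    by rewrite mulr1 => <-; rewrite !mul1r => -> ->.
  rewrite -(card_imset _ inj); apply: eq_card => P.
  apply/imsetP/mem_orb => [[y + ->] | [t t0 ->]].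
    rewrite !inE => /andP[_ /eqP E].
    by apply/mem_orb; rewrite -/(vec1 b c) -E; apply/mem_orb; exists 1; rewrite ?oner_eq0 ?psi1.
  rewrite psiE mulr1; exists (fr t * b / t, fr (fr t) * c / t).
    rewrite !inE /= !mulf_neq0 ?invr_eq0 ?fr_eq0 //=.
    apply/eqP/esym/eqP/orb_eq; exists t^-1, t; rewrite invr_eq0; split=> //.
    by rewrite psiE smulE mulr1 mulVf // ![t^-1 * _]mulrC.
  rewrite /f /=; apply/eqP; rewrite eq_sym; apply/pt_eq; exists t => //.
  by rewrite smulE mulr1 ![t * _]mulrC !mulfVK.
have := card_fibres fib; rewrite cardsX cardK1 -/off_orbits => /eqP.
have -> : ((q ^ 2 + q + 1) * (q - 1) * ((q ^ 2 + q + 1) * (q - 1)) =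
  (q ^ 2 + q + 1) * (q - 1) ^ 2 * (q ^ 2 + q + 1))%N by nia.
by rewrite eqn_pmul2r ?addn1 // => /eqP.
Qed.

Lemma planes_III_III :
  plane_class (typeIII_pt K q) (typeIII_ln K q) =
  off_orbits :\: (plane_class (typeII_pt K q) (typeIII_ln K q) :|:
    plane_class (typeIII_pt K q) (typeII_ln K q) :|: [set P2q K q]).
Proof.
apply/setP => O; rewrite in_setD.
have [/off_orbitsP[v o ->] | nO] := boolP (O \in off_orbits); last first.
  rewrite andbF inE; apply: contraNF nO => /andP[/orbSTP[v v_n0 ->] /and3P[pl _ _]].
  by apply/off_orbitsP; exists v => //; apply: Fq_plane_off.
have v_n0 := off_neq0 o; rewrite andbT !inE -typeI_orb //.
have -> : orb v \in orbST K q by apply/orbSTP; exists v.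
have oi : off (inv_vec v) by rewrite off_inv.
rewrite Fq_plane_orb // all_typeII_orb // all_typeIII_orb // lines_typeII_orb //.
rewrite lines_typeIII_orb //= !typeII_ptE ?typeIII_ptE ?off_neq0 // typeI_inv //.
case nI : (typeI_pt K q (pt v)) => //=.
(* This excludes Type II points together with Type II lines, so the remaining combinations of the
   two determinants partition the orbits other than [P2q]. *)
have : ~~ ((orbit_det v == 0) && (orbit_det (inv_vec v) == 0)).
  by apply: contraFN nI => /andP[/eqP D0 /eqP D1]; apply: orbit_det_inv_typeI.
by case: (orbit_det v == 0); case: (orbit_det (inv_vec v) == 0).
Qed.

(** The removed part consists of two disjoint classes, each of size [#|zero_sum_params|], and of
    [P2q]. *)
Lemma card_planes_III_III :
  (#|plane_class (typeIII_pt K q) (typeIII_ln K q)| + (2 * #|zero_sum_params| + 1)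
     = (q ^ 2 + q + 1) * (q - 1) ^ 2)%N.
Proof.
rewrite planes_III_III cardsD -card_off_orbits.
set A := plane_class _ _; set B := plane_class _ _.
have o1 : off (1, 1, 1) by rewrite /off /= oner_eq0.
have sub : A :|: B :|: [set P2q K q] \subset off_orbits.
  rewrite !subUset sub1set; apply/andP; split; last first.
    by rewrite P2qE; apply/off_orbitsP; exists (1, 1, 1).
  by apply/andP; split; apply/subsetP => O; rewrite inE => /andP[/orbSTP[v v_n0 ->] /and3P[pl _ _]];
     apply/off_orbitsP; exists v => //; apply: Fq_plane_off.
have nP2q : P2q K q \notin A :|: B.
  rewrite P2qE !inE all_typeII_orb ?all_typeIII_orb ?off_neq0 //.
  have : typeI_pt K q (pt (1, 1, 1)) by rewrite typeI_orb ?off_neq0 ?P2qE.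
  by rewrite /typeI_pt /typeII_pt /typeIII_pt => ->; rewrite /= !andbF.
have AB0 : A :&: B = set0.
  apply/setP => O; rewrite !inE; apply/negP.
  case/andP=> /andP[/orbSTP[v v_n0 ->]] /and3P[_]; rewrite all_typeII_orb // => H _.
  by case/and4P=> _ _; rewrite all_typeIII_orb // (negPf (typeII_III H)).
have := subset_leq_card sub.
rewrite (setIidPr sub) [_ :|: [set _]]setUC cardsU1 nP2q cardsU AB0 cards0.
rewrite card_planes_II_III card_planes_III_II; lia.
Qed.

(** * Orbits on the triangle *)

Lemma phi_inj : injective phi.
Proof. by apply: (can_inj (g := phi \o phi)) => v /=; rewrite phi3. Qed.

Lemma phiS_orb v : phiS @: (orb v) = orb (phi v).
Proof.
apply/setP => P; apply/imsetP/mem_orb => [[_ /mem_orb[t t0 ->] ->]|[t t0 ->]].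
  by exists t; rewrite // phiS_pt phi_psi.
by exists (pt (psi t v)); [apply/mem_orb; exists t | rewrite phiS_pt phi_psi].
Qed.

Lemma typeI_phi v : typeI_pt K q (pt (phi v)) = typeI_pt K q (pt v).
Proof.
rewrite /typeI_pt -phiS_pt (inj_eq (imset_inj phi_inj)) //.
Qed.

Lemma orbit_det_phi v : orbit_det (phi v) = orbit_det v.
Proof.
case: v => [[a b] c]; rewrite phiE /orbit_det /norm3 /tr3 /= !frM !fr3.
by ring.
Qed.

Lemma typeII_phi v : v != v0 -> typeII_pt K q (pt (phi v)) = typeII_pt K q (pt v).
Proof. by move=> v_n0; rewrite !typeII_ptE ?phi_eq0 // typeI_phi orbit_det_phi. Qed.
Lemma typeIII_phi v : v != v0 -> typeIII_pt K q (pt (phi v)) = typeIII_pt K q (pt v).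
Proof. by move=> v_n0; rewrite !typeIII_ptE ?phi_eq0 // typeI_phi orbit_det_phi. Qed.

Lemma in_line_phi u w v : in_line_AB K (pt u) (pt w) (orb v) ->
  in_line_AB K (pt (phi u)) (pt (phi w)) (orb (phi v)).
Proof.
case/exists_inP=> _ /PGlinesP[l l0 ->].
rewrite !incident_pt => /and3P[/eqP lu /eqP lw /forall_inP H].
apply/exists_inP; exists (pt (phi l)); first by apply/PGlinesP; exists (phi l); rewrite ?phi_eq0.
rewrite !incident_pt !dot_phi lu lw fr0 eqxx /=.
apply/forall_inP => _ /mem_orb[t t0 ->]; rewrite -phi_psi incident_pt dot_phi fr_eq0.
by rewrite -incident_pt H //; apply/mem_orb; exists t.
Qed.

Lemma sls_on_phi u w v : v != v0 -> sls_on K q (pt u) (pt w) (orb v) ->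
  sls_on K q (pt (phi u)) (pt (phi w)) (orb (phi v)).
Proof.
move=> v_n0 /andP[/andP[_ cO] /in_line_phi inl]; rewrite /sls_on inl andbT.
rewrite -{2}phiS_orb card_imset ?cO; last exact: (imset_inj phi_inj).
by rewrite andbT; apply/orbSTP; exists (phi v); rewrite ?phi_eq0.
Qed.

(** Indexed by the two vectors spanning the side: applying [phi] to both permutes the three sides
    cyclically, so only z = 0 has to be counted. *)
Definition sls_class (tp : {set vec} -> bool) (u w : vec) : {set {set {set vec}}} :=
  [set O | sls_on K q (pt u) (pt w) O & all_pts K tp O].

(* Since phi has order three, it is enough to bound one cardinal by the next. *)
Lemma card_sls_class_phi tp u w :
  (forall v, v != v0 -> all_pts K tp (orb (phi v)) = all_pts K tp (orb v)) ->
  #|sls_class tp (phi u) (phi w)| = #|sls_class tp u w|.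
Proof.
move=> tp_phi.
have step a b : (#|sls_class tp a b| <= #|sls_class tp (phi a) (phi b)|)%N.
  have inj : injective (fun O : {set {set vec}} => phiS @: O).
    by apply: imset_inj; apply: imset_inj phi_inj.
  rewrite -(card_imset _ inj); apply/subset_leq_card/subsetP => _ /imsetP[O + ->].
  rewrite !inE => /andP[sl]; have /andP[/andP[/orbSTP[v v_n0 EO] _] _] := sl.
  rewrite EO in sl * => tpO; rewrite phiS_orb sls_on_phi //=.
  by rewrite tp_phi.
apply/eqP; rewrite eqn_leq step andbT; apply: leq_trans (step _ _) _.
by apply: leq_trans (step _ _) _; rewrite !phi3.
Qed.

Lemma phi_e3 : phi (0, 0, 1) = (1, 0, 0). Proof. by rewrite phiE fr0 fr1. Qed.
Lemma phi_e1 : phi (1, 0, 0) = (0, 1, 0). Proof. by rewrite phiE fr0 fr1. Qed.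

Lemma TE : Defs.T K = pt (0, 0, 1). Proof. by []. Qed.
Lemma TphiE : Tphi K q = pt (phi (0, 0, 1)). Proof. by rewrite /Tphi TE phiS_pt. Qed.
Lemma Tphi2E : Tphi2 K q = pt (phi (phi (0, 0, 1))).
Proof. by rewrite /Tphi2 TphiE phiS_pt. Qed.

Lemma orb_side a b : a != 0 -> orb (a, b, 0) = orb (1, b / a, 0).
Proof.
move=> a0; apply/eqP/orb_eq; exists a^-1, 1; rewrite invr_eq0 oner_eq0 psi1; split=> //.
by rewrite smulE mulVf // mulr0 [a^-1 * _]mulrC.
Qed.

Lemma T_slsP O : reflect (exists2 z, z != 0 & O = orb (1, z, 0)) (T_sls K q O).
Proof.
apply: (iffP idP) => [|[z z0 ->]].
  case/andP=> /andP[/orbSTP[[[a b] c] v_n0 ->] /eqP cO].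
  rewrite TphiE Tphi2E phi_e3 phi_e1.
  case/exists_inP=> _ /PGlinesP[[[d e] f] l0 ->]; rewrite !incident_pt !dotE.
  rewrite !(mulr0, mulr1, addr0, add0r) => /and3P[/eqP d0 /eqP e0 /forall_inP H].
  have := H (pt (a, b, c)); rewrite incident_pt dotE d0 e0 !mul0r !add0r mulf_eq0.
  have -> : pt (a, b, c) \in orb (a, b, c).
    by apply/mem_orb; exists 1; rewrite ?oner_eq0 ?psi1.
  have -> /= : (f == 0) = false.
    by apply: contraNF l0 => /eqP->; rewrite d0 e0.
  move=> /(_ isT)/eqP c0; rewrite c0 in v_n0 cO *.
  (* If a further coordinate vanishes, the point is a vertex of the triangle and its orbit has one
     element instead of q^2 + q + 1. *)
  have single x : x != v0 -> (forall t, t != 0 -> pt (psi t x) = pt x) -> #|orb x| = 1%N.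
    move=> x_n0 Hx; apply/eqP/cards1P; exists (pt x); apply/setP => P; rewrite inE.
    apply/mem_orb/eqP => [[t t0 ->]|->]; first exact: Hx.
    by exists 1; rewrite ?oner_eq0 ?psi1.
  have [a0|a0] := eqVneq a 0.
    move: cO; rewrite single //; first by nia.
    move=> t t0; rewrite a0 psiE !mulr0 -[RHS](@pt_smul (fr t)) ?fr_eq0 //.
    by rewrite smulE !mulr0.
  have [b0|b0] := eqVneq b 0.
    move: cO; rewrite single //; first by nia.
    move=> t t0; rewrite b0 psiE !mulr0 -[RHS](@pt_smul t) //.
    by rewrite smulE !mulr0.
  by exists (b / a); [rewrite mulf_neq0 ?invr_eq0 | apply: orb_side].
apply/andP; split; [apply/andP; split|].
- by apply/orbSTP; exists (1, z, 0); rewrite // vec_eq0 oner_eq0.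
- by rewrite card_orb ?oner_eq0.
apply/exists_inP; exists (pt (0, 0, 1)).
  by apply/PGlinesP; exists (0, 0, 1); rewrite // vec_eq0 oner_eq0 !andbF.
rewrite TphiE Tphi2E phi_e3 phi_e1 !incident_pt !dotE !(mulr0, mul0r, addr0) eqxx /=.
by apply/forall_inP => _ /mem_orb[t t0 ->]; rewrite incident_pt psiE dotE !(mulr0, mul0r, addr0).
Qed.

(** [psi t] multiplies the ratio of the first two coordinates by t^(q-1), and by Hilbert 90 these
    factors are exactly the elements of norm 1. *)
Lemma orb_side_eq y z : y != 0 -> z != 0 ->
  (orb (1, y, 0) == orb (1, z, 0)) = (norm3 y == norm3 z).
Proof.
move=> y0 z0; apply/orb_eq/eqP => [[k [t [k0 t0]]] | E].
  rewrite psiE smulE mulr1 => -[kt -> _].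
  have -> : k = t^-1 by apply: (mulIf t0); rewrite mulVf.
  by rewrite mulrA norm3M [t^-1 * _]mulrC norm3_fr_div // mul1r.
have N1 : norm3 (z / y) = 1 by rewrite norm3M norm3V E mulfV ?norm3_eq0.
have [t t0 Et] := hilbert90 N1; exists t^-1, t; rewrite invr_eq0; split=> //.
rewrite psiE smulE mulr1 mulVf // !mulr0 mulrA [t^-1 * _]mulrC -Et.
by rewrite mulfVK.
Qed.

Lemma side_neq0 z : (1, z, 0) != v0. Proof. by rewrite vec_eq0 oner_eq0. Qed.

Lemma orbit_det_side z : orbit_det (1, z, 0) = 1 + norm3 z.
Proof. by rewrite /orbit_det /norm3 /tr3 /= !(fr0, fr1, mulr0); ring. Qed.

Lemma typeI_side z : typeI_pt K q (pt (1, z, 0)) = false.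
Proof.
by apply/negP => /(typeI_off (side_neq0 z)); rewrite /off /= eqxx !andbF.
Qed.

(** The value -1 is written as the norm of -1, so that [card_norm3_fibre] applies to this set. *)
Lemma typeII_side z : typeII_pt K q (pt (1, z, 0)) = (norm3 z == norm3 (- 1)).
Proof.
rewrite typeII_ptE ?side_neq0 // typeI_side orbit_det_side addrC addr_eq0.
by congr (_ == _); rewrite /norm3 !frsimp; ring.
Qed.

Lemma typeIII_side z : typeIII_pt K q (pt (1, z, 0)) = (norm3 z != norm3 (- 1)).
Proof.
by rewrite -typeII_side typeIII_ptE ?typeII_ptE ?side_neq0 // typeI_side.
Qed.

Lemma sls_class_image tp : sls_class tp (phi (0, 0, 1)) (phi (phi (0, 0, 1))) =
  [set orb (1, z, 0) | z in [set z : K | (z != 0) && all_pts K tp (orb (1, z, 0))]].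
Proof.
apply/setP => O; rewrite inE -TphiE -Tphi2E -/(T_sls K q O); apply/andP/imsetP.
  by case=> /T_slsP[z z0 ->] H; exists z; rewrite ?inE ?z0.
case=> z; rewrite inE => /andP[z0 H ->]; split=> //.
by apply/T_slsP; exists z.
Qed.

(** Orbits on the side correspond to norm fibres of size q^2 + q + 1; the predicate [p] expresses
    the type through the norm. *)
Lemma card_T_sls_class tp (p : pred K) :
  (forall z, z != 0 -> all_pts K tp (orb (1, z, 0)) = p (norm3 z)) ->
  (#|sls_class tp (phi (0, 0, 1)) (phi (phi (0, 0, 1)))|%R * (q ^ 2 + q + 1))%N
    = #|[set z : K | (z != 0) && p (norm3 z)]|.
Proof.
move=> tpE; rewrite sls_class_image.
have -> : [set z : K | (z != 0) && all_pts K tp (orb (1, z, 0))]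
        = [set z : K | (z != 0) && p (norm3 z)].
  by apply/setP => z; rewrite !inE; case: eqVneq => //= z0; rewrite tpE.
apply/esym/card_fibres => z; rewrite inE => /andP[z0 pz].
rewrite -(card_norm3_fibre z0); apply: eq_card => y; rewrite !inE.
have [-> | y0] /= := eqVneq y 0.
  by rewrite eq_sym /norm3 !fr0 !mul0r -/(norm3 z) norm3_eq0 (negPf z0).
by rewrite orb_side_eq //; apply: andb_idl => /eqP->.
Qed.

Lemma norm3_eq_N1_neq0 z : norm3 z == norm3 (- 1) -> z != 0.
Proof. by move/eqP=> E; rewrite -norm3_eq0 E norm3_eq0 oppr_eq0 oner_eq0. Qed.

Lemma card_T_sls_II :
  #|sls_class (typeII_pt K q) (phi (0, 0, 1)) (phi (phi (0, 0, 1)))| = 1%N.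
Proof.
have := @card_T_sls_class (typeII_pt K q) (pred1 (norm3 (- 1))).
have -> : [set z : K | (z != 0) && pred1 (norm3 (- 1)) (norm3 z)]
    = [set z | norm3 z == norm3 (- 1)].
  by apply/setP => z; rewrite !inE; apply: andb_idl; apply: norm3_eq_N1_neq0.
rewrite card_norm3_fibre ?oppr_eq0 ?oner_eq0 // => H.
have /H/eqP : forall z, z != 0 ->
    all_pts K (typeII_pt K q) (orb (1, z, 0)) = pred1 (norm3 (- 1)) (norm3 z).
  by move=> z _; rewrite all_typeII_orb ?side_neq0 // typeII_side.
by rewrite -[X in _ == X]mul1n eqn_pmul2r ?addn1 // => /eqP.
Qed.

(** The nonzero [z] form q - 1 norm fibres; the Type II fibre is removed. *)
Lemma card_T_sls_III :
  #|sls_class (typeIII_pt K q) (phi (0, 0, 1)) (phi (phi (0, 0, 1)))| = (q - 2)%N.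
Proof.
have := @card_T_sls_class (typeIII_pt K q) (predC1 (norm3 (- 1))).
have -> : [set z : K | (z != 0) && predC1 (norm3 (- 1)) (norm3 z)]
    = [set z : K | z != 0] :\: [set z | norm3 z == norm3 (- 1)].
  by apply/setP => z; rewrite !inE andbC.
rewrite cardsD cardK1 (setIidPr _); last first.
  by apply/subsetP => z; rewrite !inE; apply: norm3_eq_N1_neq0.
rewrite card_norm3_fibre ?oppr_eq0 ?oner_eq0 // => H.
have /H/eqP : forall z, z != 0 ->
    all_pts K (typeIII_pt K q) (orb (1, z, 0)) = predC1 (norm3 (- 1)) (norm3 z).
  by move=> z _; rewrite all_typeIII_orb ?side_neq0 // typeIII_side.
rewrite -[X in (_ - X)%N]muln1 -mulnBr mulnC eqn_pmul2l ?addn1 // => /eqP ->.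
lia.
Qed.

Lemma all_typeII_phi v : v != v0 ->
  all_pts K (typeII_pt K q) (orb (phi v)) = all_pts K (typeII_pt K q) (orb v).
Proof. by move=> v_n0; rewrite !all_typeII_orb ?phi_eq0 // typeII_phi. Qed.
Lemma all_typeIII_phi v : v != v0 ->
  all_pts K (typeIII_pt K q) (orb (phi v)) = all_pts K (typeIII_pt K q) (orb v).
Proof. by move=> v_n0; rewrite !all_typeIII_orb ?phi_eq0 // typeIII_phi. Qed.

Lemma T_sls_classE tp : [set O | T_sls K q O & all_pts K tp O]
  = sls_class tp (phi (0, 0, 1)) (phi (phi (0, 0, 1))).
Proof. by apply/setP => O; rewrite !inE /T_sls TphiE Tphi2E. Qed.

Lemma card_Tphi_sls tp :
  (forall v, v != v0 -> all_pts K tp (orb (phi v)) = all_pts K tp (orb v)) ->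
  #|[set O | Tphi_sls K q O & all_pts K tp O]| = #|[set O | T_sls K q O & all_pts K tp O]|.
Proof.
move=> tp_phi; rewrite T_sls_classE -(card_sls_class_phi _ _ tp_phi).
by apply: eq_card => O; rewrite !inE /Tphi_sls Tphi2E phi3.
Qed.

Lemma card_Tphi2_sls tp :
  (forall v, v != v0 -> all_pts K tp (orb (phi v)) = all_pts K tp (orb v)) ->
  #|[set O | Tphi2_sls K q O & all_pts K tp O]| = #|[set O | T_sls K q O & all_pts K tp O]|.
Proof.
move=> tp_phi; rewrite T_sls_classE -(card_sls_class_phi _ _ tp_phi).
rewrite -(card_sls_class_phi _ _ tp_phi).
by apply: eq_card => O; rewrite !inE /Tphi2_sls TphiE !phi3.
Qed.

(** * Vertices, sides and the exhaustive list of orbits *)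

Lemma orb_T : orb (0, 0, 1) = [set Defs.T K].
Proof.
apply/setP => P; rewrite inE; apply/mem_orb/eqP => [[t t0 ->]|->].
  rewrite psiE !mulr0 TE -[RHS](@pt_smul (fr (fr t))) ?fr_eq0 //.
  by rewrite smulE !mulr0.
by exists 1; rewrite ?oner_eq0 ?psi1.
Qed.

Lemma orb_Tphi : orb (phi (0, 0, 1)) = [set Tphi K q].
Proof. by rewrite -phiS_orb orb_T imset_set1. Qed.

Lemma orb_Tphi2 : orb (phi (phi (0, 0, 1))) = [set Tphi2 K q].
Proof. by rewrite -phiS_orb orb_Tphi imset_set1. Qed.

Lemma all_types_of_non_off v : v != v0 -> ~~ off v ->
  all_pts K (typeII_pt K q) (orb v) || all_pts K (typeIII_pt K q) (orb v).
Proof.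
move=> v_n0 no; rewrite all_typeII_orb // all_typeIII_orb //.
by have := type_cases v; case: (boolP (typeI_pt _ _ _)) no => // /(typeI_off v_n0) ->.
Qed.

Lemma T_sls_side a b : a != 0 -> b != 0 -> T_sls K q (orb (a, b, 0)).
Proof.
move=> a0 b0; apply/T_slsP; exists (b / a); first by rewrite mulf_neq0 ?invr_eq0.
exact: orb_side.
Qed.

Lemma Tphi_sls_side a b : a != 0 -> b != 0 -> Tphi_sls K q (orb (0, a, b)).
Proof.
move=> a0 b0; have -> : (0, a, b) = phi (fr (fr a), fr (fr b), 0) by rewrite phiE !fr3 fr0.
rewrite /Tphi_sls Tphi2E TE -{2}[(0, 0, 1)]phi3.
apply: sls_on_phi; first by rewrite vec_eq0 !fr_eq0 (negPf a0).
by rewrite -TphiE -Tphi2E; apply: T_sls_side; rewrite !fr_eq0.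
Qed.

Lemma Tphi2_sls_side a b : a != 0 -> b != 0 -> Tphi2_sls K q (orb (b, 0, a)).
Proof.
move=> a0 b0; have -> : (b, 0, a) = phi (0, fr (fr a), fr (fr b)) by rewrite phiE !fr3 fr0.
rewrite /Tphi2_sls TphiE TE -{1}[(0, 0, 1)]phi3.
apply: sls_on_phi; first by rewrite vec_eq0 !fr_eq0 (negPf a0) andbF.
by rewrite -Tphi2E -TE; apply: Tphi_sls_side; rewrite !fr_eq0.
Qed.

Lemma orbST_cases O : O \in orbST K q ->
  (O = [set Defs.T K] \/ O = [set Tphi K q] \/ O = [set Tphi2 K q]) \/
  ((T_sls K q O || Tphi_sls K q O || Tphi2_sls K q O) &&
     (all_pts K (typeII_pt K q) O || all_pts K (typeIII_pt K q) O)) \/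
  O = P2q K q \/
  (Fq_plane K q O &&
     ((all_pts K (typeII_pt K q) O && all_lines_of K q (typeIII_ln K q) O) ||
      (all_pts K (typeIII_pt K q) O && all_lines_of K q (typeII_ln K q) O) ||
      (all_pts K (typeIII_pt K q) O && all_lines_of K q (typeIII_ln K q) O))).
Proof.
case/orbSTP=> v v_n0 ->; have [o | no] := boolP (off v).
  right; right; rewrite Fq_plane_orb //=.
  have [/eqP <- | nP2q] := boolP (P2q K q == orb v); [by left | right].
  rewrite eq_sym -typeI_orb // in nP2q.
  have oi : off (inv_vec v) by rewrite off_inv.
  rewrite all_typeII_orb // all_typeIII_orb // lines_typeII_orb // lines_typeIII_orb //.
  have := type_cases v; have := type_cases (inv_vec v); rewrite typeI_inv // (negPf nP2q) /=.
  have [H _ _ | _ ] := boolP (typeII_pt K q (pt v)); first by rewrite typeII_inv.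
  by move=> + /= -> /=; case/orP=> ->; rewrite ?orbT.
rewrite all_types_of_non_off // andbT.
case: v v_n0 no => [[a b] c]; rewrite vec_eq0 /off /= !negb_and !negbK.
(* Two zero coordinates give a vertex, exactly one gives an sls on the corresponding side. *)
have [->|a0] := eqVneq a 0; have [->|b0] := eqVneq b 0; have [->|c0] := eqVneq c 0 => //= _ _.
- left; left; rewrite -orb_T; congr (orbitST _ _ _).
  by rewrite -[RHS](@pt_smul c) // smulE !mulr0 mulr1.
- left; right; right; rewrite -orb_Tphi2 phi_e3 phi_e1; congr (orbitST _ _ _).
  by rewrite -[RHS](@pt_smul b) // smulE !mulr0 mulr1.
- by right; left; rewrite Tphi_sls_side // orbT.
- left; right; left; rewrite -orb_Tphi phi_e3; congr (orbitST _ _ _).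
  by rewrite -[RHS](@pt_smul a) // smulE !mulr0 mulr1.
- by right; left; rewrite Tphi2_sls_side // orbT.
by right; left; rewrite T_sls_side.
Qed.

Lemma P2q_lines_typeI : all_lines_of K q (typeI_ln K q) (P2q K q).
Proof.
have o1 : off (1, 1, 1) by rewrite /off /= oner_eq0.
rewrite P2qE all_lines_orb // all_typeI_orb typeI_inv // typeI_orb ?off_neq0 //.
by rewrite P2qE.
Qed.

End Frobenius.

(** * The classification of the orbits *)

Unset Implicit Arguments.

Theorem theorem2p1 (K : finFieldType) (q p k : nat) :
  prime p -> (0 < k)%N -> q = (p ^ k)%N -> #|K| = (q ^ 3)%N ->
  (* (1) the three singletons *)
  [/\ [set T K] \in orbST K q, [set Tphi K q] \in orbST K q
    & [set Tphi2 K q] \in orbST K q] /\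
  (* (2) one Type-II sls of each kind *)
  [/\ #|[set O | T_sls K q O & all_pts K (typeII_pt K q) O]| = 1%N,
      #|[set O | Tphi_sls K q O & all_pts K (typeII_pt K q) O]| = 1%N
    & #|[set O | Tphi2_sls K q O & all_pts K (typeII_pt K q) O]| = 1%N] /\
  (* (3) q-2 Type-III slses of each kind *)
  [/\ #|[set O | T_sls K q O & all_pts K (typeIII_pt K q) O]|%:Z = q%:Z - 2,
      #|[set O | Tphi_sls K q O & all_pts K (typeIII_pt K q) O]|%:Z = q%:Z - 2
    & #|[set O | Tphi2_sls K q O & all_pts K (typeIII_pt K q) O]|%:Z = q%:Z - 2] /\
  (* (4) P_{2,q} *)
  [/\ P2q K q \in orbST K q, all_pts K (typeI_pt K q) (P2q K q)
    & all_lines_of K q (typeI_ln K q) (P2q K q)] /\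
  (* (5) *)
  #|[set O in orbST K q | [&& Fq_plane K q O, all_pts K (typeII_pt K q) O
                            & all_lines_of K q (typeIII_ln K q) O]]|%:Z
    = q%:Z ^+ 3 - q%:Z - 3 /\
  (* (6) *)
  #|[set O in orbST K q | [&& Fq_plane K q O, all_pts K (typeIII_pt K q) O
                            & all_lines_of K q (typeII_ln K q) O]]|%:Z
    = q%:Z ^+ 3 - q%:Z - 3 /\
  (* (7) *)
  #|[set O in orbST K q | [&& Fq_plane K q O, all_pts K (typeIII_pt K q) O
                            & all_lines_of K q (typeIII_ln K q) O]]|%:Z
    = q%:Z ^+ 4 - 3 * q%:Z ^+ 3 + q%:Z + 6 /\
  (* and nothing else *)
  (forall O, O \in orbST K q ->
     (O = [set T K] \/ O = [set Tphi K q] \/ O = [set Tphi2 K q]) \/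
     ((T_sls K q O || Tphi_sls K q O || Tphi2_sls K q O) &&
        (all_pts K (typeII_pt K q) O || all_pts K (typeIII_pt K q) O)) \/
     O = P2q K q \/
     (Fq_plane K q O &&
        ((all_pts K (typeII_pt K q) O && all_lines_of K q (typeIII_ln K q) O) ||
         (all_pts K (typeIII_pt K q) O && all_lines_of K q (typeII_ln K q) O) ||
         (all_pts K (typeIII_pt K q) O && all_lines_of K q (typeIII_ln K q) O)))).
Proof.
move=> p_pr k0 Eq cardK.
have q_gt1 : (1 < q)%N by rewrite Eq -(exp1n k) ltn_exp2r // prime_gt1.
(* The order of K is a power of p, so K has characteristic p and raising to the power q is
   additive. *)
have frobD (x y : K) : (x + y) ^+ q = x ^+ q + y ^+ q.
  apply: exprDn_pchar; rewrite Eq pnatX pnatE //.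
  by rewrite (@card_finPcharP _ _ (k * 3)) // cardK Eq expnM.
have phi_n0 v : v != v0 K -> phiv K q v != v0 K by rewrite phi_eq0.
have cY := card_zero_sum_params q_gt1 cardK frobD.
split.
  rewrite -(@orb_T K q) // -(@orb_Tphi K q) // -(@orb_Tphi2 K q) //.
  have T_n0 : (0, 0, 1) != v0 K by rewrite vec_eq0 oner_eq0 !andbF.
  split; apply/orbSTP; first by exists (0, 0, 1).
    by exists (phiv K q (0, 0, 1)); rewrite ?phi_n0.
  by exists (phiv K q (phiv K q (0, 0, 1))); rewrite ?phi_n0.
split.
  have tpI := @all_typeII_phi K q q_gt1 cardK.
  rewrite (card_Tphi_sls _ _ _ tpI) // (card_Tphi2_sls _ _ _ tpI) // T_sls_classE //.
  by rewrite card_T_sls_II.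
split.
  have E2 : (q - 2)%N%:Z = q%:Z - 2 by rewrite -subzn.
  have tpI := @all_typeIII_phi K q q_gt1 cardK.
  rewrite (card_Tphi_sls _ _ _ tpI) // (card_Tphi2_sls _ _ _ tpI) // T_sls_classE //.
  by rewrite card_T_sls_III.
split.
  have one_n0 : (1, 1, 1) != v0 K by rewrite vec_eq0 oner_eq0.
  split; last exact: P2q_lines_typeI.
    by rewrite P2qE //; apply/orbSTP; exists (1, 1, 1).
  by rewrite P2qE // all_typeI_orb // typeI_orb // P2qE.
have PoszX (m i : nat) : (m ^ i)%N%:Z = m%:Z ^+ i by rewrite -[m%:Z]natz -natrX natz.
have cYz : #|zero_sum_params K q|%:Z = q%:Z ^+ 3 - q%:Z - 3.
  by rewrite -PoszX -cY; lia.
split; [|split; [|split; last exact: orbST_cases]].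
- by rewrite -cYz; congr (Posz _); exact: (card_planes_II_III q_gt1 cardK frobD).
- by rewrite -cYz; congr (Posz _); exact: (card_planes_III_II q_gt1 cardK frobD).
have /(congr1 Posz) := card_planes_III_III q_gt1 cardK frobD.
set n := #|plane_class _ _ _|; rewrite PoszD => nE.
transitivity n%:Z; first by [].
(* The natural-number count is moved to the integers, where the two classes of size q^3 - q - 3 and
   [P2q] can be subtracted and [ring] applies. *)
transitivity ((q%:Z ^+ 2 + q%:Z + 1) * (q%:Z - 1) ^+ 2 - (2 * #|zero_sum_params K q| + 1)%N%:Z).
  rewrite -[n%:Z](addrK (2 * #|zero_sum_params K q| + 1)%N%:Z) nE; congr (_ - _).
  by rewrite PoszM !PoszD !PoszX -subzn // ltnW.
by rewrite PoszD PoszM cYz; ring.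
Qed.
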